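(* Let $0<q<1$ and $k\in\mathbb{Z}_{\ge0}$. For $\max(|a_1|,\dots,|a_{k+1}|)<|z|<1$ and for $x\in\mathbb{C}\setminus\mathbb{R}_{\ge0}$ we have $$\sum_{n=-\infty}^\infty{}_{k+1}\varphi_k\left({a_1,\dots,a_{k+1}\atop b_1,\dots,b_k};q,xq^n\right)z^n=\frac{(a_1,\dots,a_{k+1},b_1/z,\dots,b_k/z,q,xz,q/xz;q)_\infty}{(b_1,\dots,b_k,a_1/z,\dots,a_{k+1}/z,z,x,q/x;q)_\infty}.$$
   Context: Notation: $(a;q)_j=\prod_{i=0}^{j-1}(1-aq^i)$ for $j\in\mathbb{Z}_{\ge0}\cup\{\infty\}$, $(a_1,\dots,a_m;q)_j=(a_1;q)_j\cdots(a_m;q)_j$; $q/xz=q/(xz)$. ${}_{k+1}\varphi_k\left({a_1,\dots,a_{k+1}\atop b_1,\dots,b_k};q,w\right)=\sum_{j\ge0}\frac{(a_1,\dots,a_{k+1};q)_j}{(q,b_1,\dots,b_k;q)_j}w^j$ for $|w|<1$ (complex parameters, lower parameters not in $q^{\mathbb{Z}_{\le0}}$); for other arguments the one-valued analytic continuation to $\mathbb{C}\setminus\mathbb{R}_{\ge1}$ is used. *)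

(* Defs.v *)
From Stdlib Require Import Reals ZArith List ClassicalEpsilon.
From Coquelicot Require Import Coquelicot.
Import ListNotations.
Open Scope C_scope.

Fixpoint qpoch (q : R) (a : C) (j : nat) : C :=
  match j with
  | O => 1
  | S i => qpoch q a i * (1 - a * RtoC (q ^ i))
  end.

(* [iota] picks the limit when it exists; for 0 < q < 1 it always does. *)
Definition qpoch_inf (q : R) (a : C) : C :=
  iota (T := C_CompleteNormedModule)
    (fun l : C => filterlim (qpoch q a) eventually (locally l)).

Definition Cprod (s : list C) : C := fold_right Cmult 1 s.

Definition qpochs (q : R) (s : list C) (j : nat) : C :=
  Cprod (map (fun a => qpoch q a j) s).

Definition qpochs_inf (q : R) (s : list C) : C :=
  Cprod (map (qpoch_inf q) s).

Definition hyp_coef (q : R) (a b : list C) (j : nat) : C :=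
  qpochs q a j / qpochs q (RtoC q :: b) j.

Definition analytic_on (D : C -> Prop) (F : C -> C) : Prop :=
  forall w : C, D w ->
    exists (c : nat -> C) (r : posreal), forall h : C, (Cmod h < r)%R ->
      is_pseries (K := C_AbsRing) (V := C_NormedModule) c h (F (w + h)).

Definition in_real_ge (t : R) (w : C) : Prop := Im w = 0%R /\ (t <= Re w)%R.

Definition is_hyp_continuation (q : R) (a b : list C) (F : C -> C) : Prop :=
  analytic_on (fun w => ~ in_real_ge 1 w) F /\
  forall w : C, (Cmod w < 1)%R ->
    is_pseries (K := C_AbsRing) (V := C_NormedModule) (hyp_coef q a b) w (F w).

(* The basic hypergeometric function on C minus [1, oo). The two conditions of
   [is_hyp_continuation] determine its values there (identity theorem); its
   values on [1, oo) are arbitrary and must not be used. *)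
Definition qhyp (q : R) (a b : list C) : C -> C :=
  epsilon (inhabits (fun _ : C => RtoC 0)) (is_hyp_continuation q a b).

Definition Cpowz (z : C) (n : Z) : C :=
  match n with
  | Z0 => 1
  | Zpos p => Cpow z (Pos.to_nat p)
  | Zneg p => / Cpow z (Pos.to_nat p)
  end.

(* A two-sided series converges when both of its halves, n >= 0 and n < 0,
   converge independently. *)
Definition is_biseries (u : Z -> C) (l : C) : Prop :=
  exists l1 l2 : C,
    is_series (K := C_AbsRing) (V := C_NormedModule)
      (fun n : nat => u (Z.of_nat n)) l1 /\
    is_series (K := C_AbsRing) (V := C_NormedModule)
      (fun n : nat => u (- Z.of_nat (S n))%Z) l2 /\
    l = l1 + l2.

(* Main.v *)
Require Import Defs.
From Stdlib Require Import Reals ZArith List Lra Lia ClassicalEpsilon.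
From Coquelicot Require Import Coquelicot.
Import ListNotations.
Open Scope C_scope.

(** The identity reduces to the case without parameters. Put b_(k+1) = 0 and
    let h_m be the Taylor coefficients of
      H(u) = prod_i (b_i u; q)_inf / (a_i u; q)_inf,
    a product of q-binomial series ([qbinomial], [qbin_prod_sum]) that converges
    absolutely both at u = q^j and at u = 1/z, since |a_i| < |z| < 1. From
    (y; q)_j = (y; q)_inf / (y q^j; q)_inf, the coefficient of x^j in the
    hypergeometric series is a constant multiple of H(q^j) / (q; q)_j. Expanding
    H and summing over j by Euler's formula for 1/(x; q)_inf represents the
    hypergeometric function as
      c * sum_m h_m / (x q^m; q)_inf,   c = (a; q)_inf / (b; q)_inf.
    In the bilateral sum, replacing x by x q^m shifts n by m and thus costs
    z^(-m), so the result is c H(1/z) T with T = sum_n z^n / (x q^n; q)_inf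
    ([biseries_convolution], [pole_series_biseries]).

    To evaluate T, write theta(y) = (y, q/y; q)_inf. Its quasi-periodicity turns
    1/(x q^n; q)_inf into (q^(1-n)/x; q)_inf times an explicit monomial over
    theta(x). Expanding the numerator by Euler's formula and completing the
    square in the exponents of q, the double series becomes the Jacobi theta
    series at x z times sum_m z^m / (q; q)_m = 1/(z; q)_inf
    ([theta_over_qpoch], [inv_qpoch_biseries]). The same computation, with the
    factors (q^(1-n); q)_inf that vanish for n > 0, proves the Jacobi triple
    product ([jacobi_triple_product]).

    It remains to identify the continued function on the slit plane. Because
    (q; q)_inf / (x; q)_inf is a sum of simple fractions
    ([inv_qpoch_partial_fractions]), the representation above takes the form
    sum_m d_m / (1 - x q^m) with summable d_m. Such a sum has a convergent power
    series at every point other than the poles q^(-m) ([pole_series_taylor]), so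
    it is an analytic continuation of the hypergeometric series, and any other
    one agrees with it by the identity theorem, applied along rays from 0
    ([identity_theorem], [qhyp_pole_series]). *)

Local Notation csum :=
  (is_series (K := C_AbsRing) (V := C_NormedModule)).

Definition abs_summable (u : nat -> C) : Prop :=
  ex_series (fun n => Cmod (u n)).

Definition tends (u : nat -> C) (l : C) : Prop :=
  is_lim_seq (fun n => Cmod (u n - l)) 0%R.

(** * Limits and series of complex numbers *)

Lemma tends_filterlim (u : nat -> C) (l : C) :
  tends u l <->
  filterlim (U := C_NormedModule) u eventually (locally l).
Proof.
unfold tends. rewrite <- is_lim_seq_spec.
etransitivity; [| symmetry; apply (filterlim_locally_ball_norm (U := C_NormedModule) u l)].
split; intros H eps; destruct (H eps) as [N HN]; exists N; intros n Hn;
  specialize (HN n Hn); unfold ball_norm in *;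
  change (norm (minus (u n) l)) with (Cmod (u n - l)) in *.
- rewrite Rminus_0_r, Rabs_pos_eq in HN; [exact HN | apply Cmod_ge_0].
- rewrite Rminus_0_r, Rabs_pos_eq; [exact HN | apply Cmod_ge_0].
Qed.

Lemma tends_unique (u : nat -> C) (l m : C) : tends u l -> tends u m -> l = m.
Proof.
rewrite !tends_filterlim.
apply (filterlim_locally_unique (V := C_NormedModule) u).
Qed.

Lemma tends_le0 (u : nat -> C) (l : C) (v : nat -> R) :
  (forall n, Cmod (u n - l) <= v n)%R -> is_lim_seq v 0%R -> tends u l.
Proof.
intros H Hv.
apply (is_lim_seq_le_le (fun _ => 0%R) _ v); auto using is_lim_seq_const.
intros n; split; [apply Cmod_ge_0 | apply H].
Qed.

Lemma tends_ext (u v : nat -> C) (l : C) :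
  (forall n, u n = v n) -> tends u l -> tends v l.
Proof.
intros H; apply is_lim_seq_ext; intros n; now rewrite H.
Qed.

Lemma tends_const (c : C) : tends (fun _ => c) c.
Proof.
apply is_lim_seq_ext with (fun _ => 0%R); [|apply is_lim_seq_const].
intros n; replace (c - c) with (RtoC 0) by ring; now rewrite Cmod_0.
Qed.

Lemma tends_scal (c : C) (u : nat -> C) (l : C) :
  tends u l -> tends (fun n => c * u n) (c * l).
Proof.
intros H.
apply tends_le0 with (fun n => Cmod c * Cmod (u n - l))%R.
- intros n; rewrite <- Cmod_mult; right; f_equal; ring.
- replace (Finite 0) with (Rbar_mult (Cmod c) 0%R) by (simpl; f_equal; ring).
  now apply is_lim_seq_scal_l.
Qed.

Lemma tends_plus (u v : nat -> C) (l m : C) :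
  tends u l -> tends v m -> tends (fun n => u n + v n) (l + m).
Proof.
intros H K.
apply tends_le0 with (fun n => Cmod (u n - l) + Cmod (v n - m))%R.
- intros n; replace (u n + v n - (l + m)) with ((u n - l) + (v n - m)) by ring.
  apply Cmod_triangle.
- replace (Finite 0) with (Finite (0 + 0)) by (f_equal; ring).
  now apply is_lim_seq_plus'.
Qed.

Lemma tends_mult (u v : nat -> C) (l m : C) :
  tends u l -> tends v m -> tends (fun n => u n * v n) (l * m).
Proof.
intros H K.
apply tends_le0 with
  (fun n => Cmod (u n - l) * Cmod (v n - m) + Cmod m * Cmod (u n - l)
            + Cmod l * Cmod (v n - m))%R.
- intros n.
  replace (u n * v n - l * m)
    with ((u n - l) * (v n - m) + m * (u n - l) + l * (v n - m)) by ring.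
  rewrite <- !Cmod_mult.
  eapply Rle_trans; [apply Cmod_triangle|].
  apply Rplus_le_compat_r, Cmod_triangle.
- replace (Finite 0) with (Finite (0 * 0 + Cmod m * 0 + Cmod l * 0))
    by (f_equal; ring).
  repeat apply is_lim_seq_plus'; apply is_lim_seq_mult'; auto using is_lim_seq_const.
Qed.

Lemma tends_incr_1 (u : nat -> C) (l : C) :
  tends (fun n => u (S n)) l <-> tends u l.
Proof.
split; apply (is_lim_seq_incr_1 (fun n => Cmod (u n - l))).
Qed.

Lemma tends_Cmod_le (u : nat -> C) (l : C) (M : R) :
  (forall n, Cmod (u n) <= M)%R -> tends u l -> (Cmod l <= M)%R.
Proof.
intros H Hl.
assert (E : Rbar_le (Cmod l) (M + 0)%R).
{ apply (is_lim_seq_le (fun _ => Cmod l) (fun n => M + Cmod (u n - l))%R).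
  - intros n. replace l with (u n + - (u n - l)) at 1 by ring.
    eapply Rle_trans; [apply Cmod_triangle|].
    rewrite Cmod_opp; apply Rplus_le_compat_r, H.
  - apply is_lim_seq_const.
  - apply is_lim_seq_plus'; [apply is_lim_seq_const | exact Hl]. }
simpl in E; lra.
Qed.

Lemma csum_tends (u : nat -> C) (l : C) : csum u l <-> tends (sum_n u) l.
Proof. now rewrite tends_filterlim. Qed.

Lemma csum_unique (u : nat -> C) (l m : C) : csum u l -> csum u m -> l = m.
Proof. rewrite !csum_tends; apply tends_unique. Qed.

Lemma csum_ext (u v : nat -> C) (l : C) :
  (forall n, u n = v n) -> csum u l -> csum v l.
Proof. intros H; now apply is_series_ext. Qed.

Lemma csum_scal (c : C) (u : nat -> C) (l : C) :
  csum u l -> csum (fun n => c * u n) (c * l).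
Proof. exact (is_series_scal (K := C_AbsRing) (V := C_NormedModule) c u l). Qed.

Lemma csum_plus (u v : nat -> C) (l m : C) :
  csum u l -> csum v m -> csum (fun n => u n + v n) (l + m).
Proof. apply (is_series_plus (V := C_NormedModule)). Qed.

Lemma csum_minus (u v : nat -> C) (l m : C) :
  csum u l -> csum v m -> csum (fun n => u n - v n) (l - m).
Proof. apply (is_series_minus (V := C_NormedModule)). Qed.

Lemma csum_incr_1 (u : nat -> C) (l : C) :
  csum u l -> csum (fun n => u (S n)) (l - u O).
Proof.
intros H; apply (is_series_incr_1 (V := C_NormedModule)).
change (csum u (l - u O + u O)). now replace (l - u O + u O) with l by ring.
Qed.

Lemma csum_decr_1 (u : nat -> C) (l : C) :
  csum (fun n => u (S n)) l -> csum u (u O + l).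
Proof.
intros H; apply (is_series_decr_1 (V := C_NormedModule)).
change (csum (fun n => u (S n)) (u O + l - u O)).
now replace (u O + l - u O) with l by ring.
Qed.

Lemma sum_n_C (u : nat -> C) (n : nat) : sum_n u (S n) = sum_n u n + u (S n) :> C.
Proof. now rewrite sum_Sn. Qed.

Lemma sum_n_Re (u : nat -> R) (n : nat) : sum_n u (S n) = (sum_n u n + u (S n))%R.
Proof. now rewrite sum_Sn. Qed.

Lemma csum_finite (u : nat -> nat -> C) (s : nat -> C) (N : nat) :
  (forall n, csum (fun i => u i n) (s n)) ->
  csum (fun i => sum_n (u i) N) (sum_n s N).
Proof.
intros H; induction N as [|N IH].
- rewrite sum_O. apply csum_ext with (2 := H O). intros n; now rewrite sum_O.
- rewrite sum_n_C. apply csum_ext with (fun i => sum_n (u i) N + u i (S N)).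
  + intros i; now rewrite sum_n_C.
  + now apply csum_plus.
Qed.

Lemma csum_single (u : nat -> C) :
  (forall n, u (S n) = 0) -> csum u (u O).
Proof.
intros H. apply csum_tends. apply tends_ext with (fun _ => u O); [|apply tends_const].
intros n; induction n as [|n IH]; [now rewrite sum_O|].
rewrite sum_n_C, <- IH, H; ring.
Qed.

(** * Absolute convergence and interchange of summations *)

Lemma abs_summable_le (u : nat -> C) (A : nat -> R) :
  (forall n, Cmod (u n) <= A n)%R -> ex_series A -> abs_summable u.
Proof.
intros H; apply (ex_series_le (V := R_CompleteNormedModule)).
intros n; change (Rabs (Cmod (u n)) <= A n)%R.
rewrite Rabs_pos_eq; [apply H | apply Cmod_ge_0].
Qed.

Lemma abs_summable_csum (u : nat -> C) : abs_summable u -> exists l : C, csum u l.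
Proof.
intros H.
apply (ex_series_le (V := C_CompleteNormedModule) u (fun n => Cmod (u n))).
- intros n; apply Rle_refl.
- exact H.
Qed.

Lemma abs_summable_ext (u v : nat -> C) :
  (forall n, u n = v n) -> abs_summable u -> abs_summable v.
Proof. intros H; apply ex_series_ext; intros n; now rewrite H. Qed.

Lemma Cmod_sum_n_le (u : nat -> C) (n : nat) :
  (Cmod (sum_n u n) <= sum_n (fun k => Cmod (u k)) n)%R.
Proof.
induction n as [|n IH]; [rewrite !sum_O; apply Rle_refl|].
rewrite sum_n_C, sum_n_Re.
eapply Rle_trans; [apply Cmod_triangle|]. lra.
Qed.

Lemma sum_n_le_Series (a : nat -> R) (n : nat) :
  (forall k, 0 <= a k)%R -> ex_series a -> (sum_n a n <= Series a)%R.
Proof.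
intros Ha H.
apply (is_lim_seq_incr_compare (sum_n a)).
- apply (Series_correct _ H).
- intros k; rewrite sum_n_Re; specialize (Ha (S k)); lra.
Qed.

Lemma csum_norm_le (u : nat -> C) (l : C) :
  csum u l -> abs_summable u -> (Cmod l <= Series (fun n => Cmod (u n)))%R.
Proof.
rewrite csum_tends; intros H K.
apply tends_Cmod_le with (2 := H).
intros n; eapply Rle_trans; [apply Cmod_sum_n_le|].
apply (sum_n_le_Series (fun k => Cmod (u k))); auto.
intros; apply Cmod_ge_0.
Qed.

(** Dominated convergence for series: split the sum at an index beyond which
    the majorant is small, and use termwise convergence on the head. *)
Lemma tannery_R (u : nat -> nat -> R) (A : nat -> R) :
  (forall N m, 0 <= u N m <= A m)%R -> ex_series A ->
  (forall m, is_lim_seq (fun N => u N m) 0%R) ->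
  is_lim_seq (fun N => Series (u N)) 0%R.
Proof.
intros Hu HA Hlim.
assert (Hex : forall N, ex_series (u N)).
{ intros N; apply (ex_series_le (V := R_CompleteNormedModule)) with A; auto.
  intros m; change (Rabs (u N m) <= A m)%R; rewrite Rabs_pos_eq; apply Hu. }
assert (HA0 : forall m, (0 <= A m)%R) by (intros m; destruct (Hu O m); lra).
apply is_lim_seq_spec; intros eps.
assert (Htail : exists M, (Series A - sum_n A M < eps / 2)%R).
{ pose proof (Series_correct _ HA) as HS.
  assert (HS' : is_lim_seq (sum_n A) (Series A)) by exact HS.
  apply is_lim_seq_spec in HS'.
  destruct (HS' (pos_div_2 eps)) as [M HM]. exists M.
  specialize (HM M (le_n _)). simpl in HM.
  apply Rabs_def2 in HM; lra. }
destruct Htail as [M HM].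
assert (Hhead : is_lim_seq (fun N => sum_n (u N) M) 0%R).
{ clear HM; induction M as [|M IH].
  - apply is_lim_seq_ext with (2 := Hlim O); intros; now rewrite sum_O.
  - apply is_lim_seq_ext with (fun N => sum_n (u N) M + u N (S M))%R.
    { intros; now rewrite sum_n_Re. }
    replace (Finite 0) with (Finite (0 + 0)) by (f_equal; ring).
    now apply is_lim_seq_plus'. }
apply is_lim_seq_spec in Hhead.
destruct (Hhead (pos_div_2 eps)) as [N0 HN]; exists N0; intros N HN0.
specialize (HN N HN0); simpl in HN.
rewrite Rminus_0_r in *. apply Rabs_def2 in HN.
assert (H1 : (0 <= Series (u N))%R).
{ apply Rle_trans with (sum_n (u N) O).
  - rewrite sum_O; apply Hu.
  - apply sum_n_le_Series; auto; intros; apply Hu. }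
rewrite Rabs_pos_eq by exact H1.
assert (H2 : (Series (u N) - sum_n (u N) M <= Series A - sum_n A M)%R).
{ rewrite (Series_incr_n (u N) (S M)), (Series_incr_n A (S M)) by (auto; lia).
  simpl pred. rewrite !sum_n_Reals.
  assert (Series (fun k => u N (S M + k)%nat) <= Series (fun k => A (S M + k)%nat))%R.
  { apply Series_le.
    - intros; apply Hu.
    - now apply -> (ex_series_incr_n (V := R_NormedModule) A). }
  lra. }
lra.
Qed.

Lemma tannery (u : nat -> nat -> C) (v s : nat -> C) (A : nat -> R) :
  (forall N m, Cmod (u N m) <= A m)%R -> ex_series A ->
  (forall m, tends (fun N => u N m) (v m)) ->
  (forall N, csum (u N) (s N)) ->
  exists S : C, csum v S /\ tends s S.
Proof.
intros Hu HA Hv Hs.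
assert (HvA : forall m, (Cmod (v m) <= A m)%R).
{ intros m; apply tends_Cmod_le with (fun N => u N m); auto. }
destruct (abs_summable_csum v) as [S HS].
{ now apply abs_summable_le with A. }
exists S; split; auto.
assert (Hd : forall N m, (0 <= Cmod (u N m - v m) <= 2 * A m)%R).
{ intros N m; split; [apply Cmod_ge_0|].
  unfold Cminus; eapply Rle_trans; [apply Cmod_triangle|].
  rewrite Cmod_opp; specialize (Hu N m); specialize (HvA m); lra. }
assert (H2A : ex_series (fun m => 2 * A m)%R)
  by exact (ex_series_scal (V := R_NormedModule) 2%R A HA).
apply tends_le0 with (fun N => Series (fun m => Cmod (u N m - v m))).
- intros N. apply (csum_norm_le (fun m => u N m - v m)).
  + now apply csum_minus.
  + apply abs_summable_le with (2 := H2A). apply Hd.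
- apply tannery_R with (1 := Hd); auto.
Qed.

(** Interchange of summations: the partial sums over the second index are
    dominated by [A], so that [tannery] lets them tend to infinity under the
    sum over the first index. *)
Lemma series_swap (u : nat -> nat -> C) (A : nat -> R) (r s : nat -> C) (T : C) :
  (forall i n, sum_n (fun k => Cmod (u i k)) n <= A i)%R -> ex_series A ->
  (forall i, csum (u i) (r i)) ->
  (forall n, csum (fun i => u i n) (s n)) ->
  csum r T -> csum s T.
Proof.
intros Hu HA Hr Hs HT.
destruct (tannery (fun N i => sum_n (u i) N) r (sum_n s) A) as [S [HS1 HS2]]; auto.
- intros N i; eapply Rle_trans; [apply Cmod_sum_n_le | apply Hu].
- intros i; now apply csum_tends.
- intros N; now apply csum_finite.
- rewrite (csum_unique _ _ _ HT HS1). now apply csum_tends.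
Qed.

(** The ratio test, in a form that tolerates vanishing terms. *)
Lemma ratio_test (u : nat -> C) (rho : nat -> R) (L : R) :
  (forall n, Cmod (u (S n)) <= rho n * Cmod (u n))%R ->
  is_lim_seq rho L -> (L < 1)%R -> abs_summable u.
Proof.
intros Hu Hrho HL.
set (k := Rmax 0 ((L + 1) / 2)).
assert (Hk : (0 <= k < 1)%R).
{ unfold k; split; [apply Rmax_l | apply Rmax_lub_lt; lra]. }
assert (Hd : (0 < (1 - L) / 2)%R) by lra.
apply is_lim_seq_spec in Hrho.
destruct (Hrho (mkposreal _ Hd)) as [N HN]; simpl in HN.
apply (ex_series_incr_n (V := R_NormedModule) (fun n => Cmod (u n)) N).
assert (Hg : forall n, (Cmod (u (N + n)%nat) <= Cmod (u N) * k ^ n)%R).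
{ induction n as [|n IH]; [rewrite Nat.add_0_r; simpl; lra|].
  rewrite Nat.add_succ_r; eapply Rle_trans; [apply Hu|].
  assert (Hrk : (rho (N + n)%nat <= k)%R).
  { unfold k; eapply Rle_trans; [|apply Rmax_r].
    specialize (HN (N + n)%nat ltac:(lia)); apply Rabs_def2 in HN; lra. }
  eapply Rle_trans; [apply Rmult_le_compat_r; [apply Cmod_ge_0 | exact Hrk]|].
  simpl pow. rewrite (Rmult_comm k (k ^ n)), <- Rmult_assoc, Rmult_comm.
  apply Rmult_le_compat_r; [lra | exact IH]. }
apply (abs_summable_le (fun n => u (N + n)%nat)) with (1 := Hg).
apply (ex_series_scal (V := R_NormedModule) (Cmod (u N)) (fun n => k ^ n)%R).
apply ex_series_geom. rewrite Rabs_pos_eq; lra.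
Qed.

(** * Powers of q *)

Lemma qpow_lim (q : R) : (0 < q < 1)%R -> is_lim_seq (fun n => q ^ n)%R 0%R.
Proof. intros hq; apply is_lim_seq_geom; rewrite Rabs_pos_eq; lra. Qed.

Lemma qpow_bounds (q : R) (n : nat) : (0 < q < 1)%R -> (0 < q ^ n <= 1)%R.
Proof.
intros hq; split; [apply pow_lt; lra|].
rewrite <- (pow1 n); apply pow_incr; lra.
Qed.

Lemma qpow_S_lt1 (q : R) (n : nat) : (0 < q < 1)%R -> (q ^ S n < 1)%R.
Proof.
intros hq; destruct (qpow_bounds q n hq); simpl.
apply Rle_lt_trans with (q * 1)%R; [apply Rmult_le_compat_l|]; lra.
Qed.

Lemma RtoC_qpow_S (q : R) (n : nat) : RtoC (q ^ S n) = RtoC q * RtoC (q ^ n).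
Proof. simpl; apply RtoC_mult. Qed.

Lemma RtoC_qpow_add (q : R) (n m : nat) :
  RtoC (q ^ (n + m)) = RtoC (q ^ n) * RtoC (q ^ m).
Proof. now rewrite pow_add, RtoC_mult. Qed.

Lemma RtoC_neq0 (r : R) : r <> 0%R -> RtoC r <> 0.
Proof. intros H K; apply H, RtoC_inj, K. Qed.

Lemma one_minus_qpow_S_neq0 (q : R) (n : nat) :
  (0 < q < 1)%R -> 1 - RtoC (q ^ S n) <> 0.
Proof.
intros hq; rewrite <- RtoC_minus; apply RtoC_neq0.
pose proof (qpow_S_lt1 q n hq); lra.
Qed.

Lemma one_minus_neq0 (c : C) : (Cmod c < 1)%R -> 1 - c <> 0.
Proof.
intros H K. replace c with (RtoC 1) in H by (rewrite <- (Cplus_0_r c), <- K; ring).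
rewrite Cmod_1 in H; lra.
Qed.

Lemma Cmod_RtoC_pos (r : R) : (0 <= r)%R -> Cmod (RtoC r) = r.
Proof. intros; rewrite Cmod_R; now apply Rabs_pos_eq. Qed.

Lemma Cmod_qpow_le (q : R) (c : C) (n : nat) :
  (0 < q < 1)%R -> (Cmod (c * RtoC (q ^ n)) <= Cmod c)%R.
Proof.
intros hq; destruct (qpow_bounds q n hq).
rewrite Cmod_mult, Cmod_RtoC_pos by lra.
pose proof (Cmod_ge_0 c). rewrite <- (Rmult_1_r (Cmod c)) at 2.
apply Rmult_le_compat_l; lra.
Qed.

Lemma tends_qpow (q : R) (c : C) :
  (0 < q < 1)%R -> tends (fun n => c * RtoC (q ^ n)) 0.
Proof.
intros hq; apply tends_le0 with (fun n => Cmod c * q ^ n)%R.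
- intros n; destruct (qpow_bounds q n hq).
  replace (c * RtoC (q ^ n) - 0) with (c * RtoC (q ^ n)) by ring.
  rewrite Cmod_mult, Cmod_RtoC_pos; lra.
- replace (Finite 0) with (Rbar_mult (Cmod c) 0%R) by (simpl; f_equal; ring).
  apply is_lim_seq_scal_l, qpow_lim, hq.
Qed.

Lemma qpow_small (q : R) (y : C) :
  (0 < q < 1)%R -> exists n, (Cmod (y * RtoC (q ^ n)) < 1)%R.
Proof.
intros hq; assert (H := tends_qpow q y hq). unfold tends in H.
apply is_lim_seq_spec in H. destruct (H (mkposreal 1 Rlt_0_1)) as [N HN].
exists N; specialize (HN N (le_n _)); simpl in HN.
rewrite Rminus_0_r, Rabs_pos_eq in HN by apply Cmod_ge_0.
now replace (y * RtoC (q ^ N) - 0) with (y * RtoC (q ^ N)) in HN by ring.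
Qed.

(** * Infinite q-shifted factorials *)

(** From |1 - a q^i| <= exp (|a| q^i) and the geometric series. *)
Lemma qpoch_bounded (q : R) (a : C) (n : nat) :
  (0 < q < 1)%R -> (Cmod (qpoch q a n) <= exp (Cmod a * / (1 - q)))%R.
Proof.
intros hq.
assert (Hq : (0 < / (1 - q))%R) by (apply Rinv_0_lt_compat; lra).
apply Rle_trans with (exp (Cmod a * ((1 - q ^ n) * / (1 - q)))).
- induction n as [|n IH]; simpl qpoch.
  + rewrite Cmod_1; simpl. rewrite Rminus_diag, Rmult_0_l, Rmult_0_r, exp_0; lra.
  + rewrite Cmod_mult.
    replace (Cmod a * ((1 - q ^ S n) * / (1 - q)))%R
      with (Cmod a * ((1 - q ^ n) * / (1 - q)) + Cmod a * q ^ n)%R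
      by (simpl; field; lra).
    rewrite exp_plus. apply Rmult_le_compat; auto using Cmod_ge_0.
    eapply Rle_trans; [|apply exp_ineq1_le].
    unfold Cminus; eapply Rle_trans; [apply Cmod_triangle|].
    rewrite Cmod_opp, Cmod_1, Cmod_mult, Cmod_RtoC_pos; [lra|].
    destruct (qpow_bounds q n hq); lra.
- assert (Hexp : forall r s, (r <= s)%R -> (exp r <= exp s)%R).
  { intros r s [H | ->]; [left; now apply exp_increasing | apply Rle_refl]. }
  apply Hexp, Rmult_le_compat_l; [apply Cmod_ge_0|].
  destruct (qpow_bounds q n hq).
  rewrite <- (Rmult_1_l (/ (1 - q))) at 2. apply Rmult_le_compat_r; lra.
Qed.

Lemma qpoch_inf_tends (q : R) (a : C) :
  (0 < q < 1)%R -> tends (qpoch q a) (qpoch_inf q a).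
Proof.
intros hq.
(* consecutive partial products differ by a geometrically small amount *)
destruct (abs_summable_csum (fun n => qpoch q a (S n) - qpoch q a n)) as [l Hl].
{ apply abs_summable_le
    with (fun n => exp (Cmod a * / (1 - q)) * Cmod a * q ^ n)%R.
  - intros n; simpl qpoch.
    replace (qpoch q a n * (1 - a * RtoC (q ^ n)) - qpoch q a n)
      with (- (qpoch q a n * a * RtoC (q ^ n))) by ring.
    destruct (qpow_bounds q n hq).
    rewrite Cmod_opp, !Cmod_mult, (Cmod_RtoC_pos (q ^ n)) by lra.
    apply Rmult_le_compat_r; [lra|].
    apply Rmult_le_compat_r; [apply Cmod_ge_0|]. now apply qpoch_bounded.
  - apply (ex_series_scal (V := R_NormedModule) _ (fun n => q ^ n)%R).
    apply ex_series_geom. rewrite Rabs_pos_eq; lra. }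
apply csum_tends in Hl.
assert (H : tends (qpoch q a) (l + 1)).
{ apply tends_incr_1.
  apply tends_ext
    with (fun n => sum_n (fun n => qpoch q a (S n) - qpoch q a n) n + 1).
  - intros n; induction n as [|n IH].
    + rewrite sum_O; simpl; ring.
    + rewrite sum_n_C.
      transitivity (sum_n (fun n => qpoch q a (S n) - qpoch q a n) n + 1
                    + (qpoch q a (S (S n)) - qpoch q a (S n))); [ring|].
      rewrite IH; ring.
  - apply tends_plus; auto using tends_const. }
unfold qpoch_inf.
rewrite (iota_filterlim_locally (V := C_CompleteNormedModule) (qpoch q a) (l + 1)).
- exact H.
- now apply tends_filterlim.
Qed.

Lemma qpoch_inf_0 (q : R) : (0 < q < 1)%R -> qpoch_inf q 0 = 1.
Proof.
intros hq; apply tends_unique with (qpoch q 0); [now apply qpoch_inf_tends|].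
apply tends_ext with (2 := tends_const 1).
intros n; induction n as [|n IH]; simpl; [|rewrite <- IH]; ring.
Qed.

Lemma qpoch_succ_r (q : R) (a : C) (n : nat) :
  qpoch q a (S n) = qpoch q a n * (1 - a * RtoC (q ^ n)).
Proof. reflexivity. Qed.

Lemma qpoch_succ_l (q : R) (a : C) (n : nat) :
  qpoch q a (S n) = (1 - a) * qpoch q (a * RtoC q) n.
Proof.
induction n as [|n IH]; [simpl; ring|].
rewrite qpoch_succ_r, IH, qpoch_succ_r, RtoC_qpow_S; ring.
Qed.

Lemma qpoch_inf_succ (q : R) (a : C) :
  (0 < q < 1)%R -> qpoch_inf q a = (1 - a) * qpoch_inf q (a * RtoC q).
Proof.
intros hq; apply tends_unique with (fun n => qpoch q a (S n)).
- now apply tends_incr_1, qpoch_inf_tends.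
- apply tends_ext with (fun n => (1 - a) * qpoch q (a * RtoC q) n).
  + intros n; symmetry; apply qpoch_succ_l.
  + now apply tends_scal, qpoch_inf_tends.
Qed.

Lemma qpoch_inf_split (q : R) (a : C) (n : nat) :
  (0 < q < 1)%R ->
  qpoch_inf q a = qpoch q a n * qpoch_inf q (a * RtoC (q ^ n)).
Proof.
intros hq; induction n as [|n IH].
- simpl; rewrite !Cmult_1_r; ring.
- rewrite IH, (qpoch_inf_succ q (a * RtoC (q ^ n))) by exact hq.
  rewrite RtoC_qpow_S; simpl.
  replace (a * (RtoC q * RtoC (q ^ n))) with (a * RtoC (q ^ n) * RtoC q) by ring.
  ring.
Qed.

Lemma qpoch_neq0 (q : R) (a : C) (n : nat) :
  (forall m, 1 - a * RtoC (q ^ m) <> 0) -> qpoch q a n <> 0.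
Proof.
intros H; induction n as [|n IH]; simpl; [exact C1_nz | now apply Cmult_neq_0].
Qed.

(** * The q-binomial theorem *)

(** Taylor coefficients of (b u; q)_inf / (a u; q)_inf. This is
    a^m (b/a; q)_m / (q; q)_m, written so that it also makes sense for a = 0. *)
Fixpoint qbin (q : R) (a b : C) (m : nat) : C :=
  match m with
  | O => 1
  | S i => qbin q a b i * (a - b * RtoC (q ^ i)) / (1 - RtoC (q ^ S i))
  end.

Lemma qbin_abs_summable (q : R) (a b u : C) :
  (0 < q < 1)%R -> (Cmod (a * u) < 1)%R ->
  abs_summable (fun m => qbin q a b m * u ^ m).
Proof.
intros hq hu.
apply ratio_test with (L := Cmod (a * u))
  (rho := fun m => ((Cmod (a * u) + Cmod (b * u) * q ^ m) / (1 - q ^ S m))%R);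
  auto.
- intros n. pose proof (qpow_S_lt1 q n hq). destruct (qpow_bounds q n hq).
  replace (qbin q a b (S n) * u ^ S n)
    with ((a * u + - (b * u * RtoC (q ^ n))) / RtoC (1 - q ^ S n)
          * (qbin q a b n * u ^ n)).
  + rewrite Cmod_mult. apply Rmult_le_compat_r; [apply Cmod_ge_0|].
    rewrite Cmod_div by (apply RtoC_neq0; lra).
    rewrite Cmod_RtoC_pos by lra.
    apply Rmult_le_compat_r; [left; apply Rinv_0_lt_compat; lra|].
    eapply Rle_trans; [apply Cmod_triangle|].
    rewrite Cmod_opp, (Cmod_mult _ (RtoC (q ^ n))), (Cmod_RtoC_pos (q ^ n)); lra.
  + pose proof (one_minus_qpow_S_neq0 q n hq).
    change (qbin q a b (S n))
      with (qbin q a b n * (a - b * RtoC (q ^ n)) / (1 - RtoC (q ^ S n))).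
    change (u ^ S n) with (u * u ^ n).
    rewrite RtoC_minus. field. exact H2.
- replace (Finite (Cmod (a * u)))
    with (Finite ((Cmod (a * u) + Cmod (b * u) * 0) / (1 - 0)))
    by (f_equal; field).
  apply is_lim_seq_div'; [| |lra].
  + apply is_lim_seq_plus'; [apply is_lim_seq_const|].
    apply is_lim_seq_mult'; [apply is_lim_seq_const | now apply qpow_lim].
  + apply is_lim_seq_minus'; [apply is_lim_seq_const|].
    apply (is_lim_seq_incr_1 (fun m => q ^ m)%R). now apply qpow_lim.
Qed.

(** Comparing coefficients in (1 - a v) G(v) = (1 - b v) G(q v). *)
Lemma qbin_functional_equation (q : R) (a b v g g' : C) :
  (0 < q < 1)%R ->
  csum (fun m => qbin q a b m * v ^ m) g ->
  csum (fun m => qbin q a b m * (v * RtoC q) ^ m) g' ->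
  (1 - a * v) * g = (1 - b * v) * g'.
Proof.
intros hq Hg Hg'.
assert (Hpow : forall m, (v * RtoC q) ^ m = v ^ m * RtoC (q ^ m)).
{ induction m as [|m IH]; [simpl; ring|].
  rewrite RtoC_qpow_S; simpl; rewrite IH; ring. }
assert (E1 : csum (fun m => qbin q a b (S m) * (1 - RtoC (q ^ S m)) * v ^ S m)
               (g - g')).
{ replace (g - g') with (g - g' - qbin q a b 0 * (1 - RtoC (q ^ 0)) * v ^ 0)
    by (simpl; ring).
  apply (csum_incr_1 (fun m => qbin q a b m * (1 - RtoC (q ^ m)) * v ^ m)).
  apply csum_ext with (2 := csum_minus _ _ _ _ Hg Hg').
  intros m; rewrite Hpow; ring. }
assert (E2 : csum (fun m => qbin q a b (S m) * (1 - RtoC (q ^ S m)) * v ^ S m)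
               (a * v * g - b * v * g')).
{ apply csum_ext
    with (2 := csum_minus _ _ _ _ (csum_scal (a * v) _ _ Hg) (csum_scal (b * v) _ _ Hg')).
  intros m; rewrite Hpow. pose proof (one_minus_qpow_S_neq0 q m hq).
  change (qbin q a b (S m))
      with (qbin q a b m * (a - b * RtoC (q ^ m)) / (1 - RtoC (q ^ S m))).
  change (v ^ S m) with (v * v ^ m). field. exact H. }
pose proof (csum_unique _ _ _ E1 E2) as E.
replace ((1 - a * v) * g) with (g - g' + g' - a * v * g) by ring.
rewrite E; ring.
Qed.

(** Iterating the functional equation moves the argument to 0, where the series
    takes the value 1. *)
Lemma qbinomial_mult (q : R) (a b u g : C) :
  (0 < q < 1)%R -> (Cmod (a * u) < 1)%R ->
  csum (fun m => qbin q a b m * u ^ m) g ->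
  qpoch_inf q (a * u) * g = qpoch_inf q (b * u).
Proof.
intros hq hu Hg.
assert (Habs := qbin_abs_summable q a b u hq hu).
assert (Hsmall : forall n, (Cmod (a * (u * RtoC (q ^ n))) < 1)%R).
{ intros n; rewrite Cmult_assoc.
  eapply Rle_lt_trans; [now apply Cmod_qpow_le | exact hu]. }
destruct (ClassicalEpsilon.choice
  (fun (n : nat) (g : C) => csum (fun m => qbin q a b m * (u * RtoC (q ^ n)) ^ m) g))
  as [G HG].
{ intros n; apply abs_summable_csum, qbin_abs_summable; auto. }
assert (HG0 : G O = g).
{ apply csum_unique with (2 := Hg).
  apply csum_ext with (2 := HG O); intros m; now rewrite Cmult_1_r. }
assert (HGn : forall n, qpoch q (a * u) n * g = qpoch q (b * u) n * G n).
{ induction n as [|n IH]; [simpl; rewrite HG0; ring|].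
  simpl qpoch.
  assert (E := qbin_functional_equation q a b (u * RtoC (q ^ n)) (G n) (G (S n))
    hq (HG n)).
  replace (qpoch q (a * u) n * (1 - a * u * RtoC (q ^ n)) * g)
    with (qpoch q (a * u) n * g * (1 - a * (u * RtoC (q ^ n)))) by ring.
  rewrite IH.
  transitivity (qpoch q (b * u) n * ((1 - a * (u * RtoC (q ^ n))) * G n)); [ring|].
  rewrite E; [ring|].
  apply csum_ext with (2 := HG (S n)); intros m.
  rewrite RtoC_qpow_S. do 2 f_equal. ring. }
assert (HGlim : tends G 1).
{ destruct (tannery
    (fun n m => qbin q a b m * (u * RtoC (q ^ n)) ^ m)
    (fun m => match m with O => 1 | S _ => 0 end) G
    (fun m => Cmod (qbin q a b m * u ^ m))) as [S [HS HGS]]; auto.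
  - intros n m; rewrite !Cmod_mult, !Cmod_pow.
    apply Rmult_le_compat_l; [apply Cmod_ge_0|].
    apply pow_incr; split; [apply Cmod_ge_0 | now apply Cmod_qpow_le].
  - intros [|m].
    + apply tends_ext with (2 := tends_const 1); intros n; simpl; ring.
    + assert (Hu0 := tends_qpow q u hq).
      assert (Hpow : forall k, exists l,
        tends (fun n => (u * RtoC (q ^ n)) ^ k) l).
      { induction k as [|k [l IH]].
        - exists 1; apply (tends_const 1).
        - exists (0 * l); simpl; now apply tends_mult. }
      destruct (Hpow m) as [l Hl].
      replace (RtoC 0) with (qbin q a b (S m) * (0 * l)) by ring.
      apply tends_scal; simpl; now apply tends_mult.
  - replace (RtoC 1) with S; [exact HGS|].
    apply csum_unique with (1 := HS).
    apply (csum_single (fun m => match m with O => 1 | S _ => 0 end)); auto. }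
apply tends_unique with (fun n => qpoch q (a * u) n * g).
- apply tends_mult; [now apply qpoch_inf_tends | apply tends_const].
- apply tends_ext with (fun n => qpoch q (b * u) n * G n); auto.
  replace (qpoch_inf q (b * u)) with (qpoch_inf q (b * u) * 1) by ring.
  apply tends_mult; auto. now apply qpoch_inf_tends.
Qed.

(** The case b = 0 of the q-binomial series exhibits an inverse of
    (y; q)_inf in the unit disk; outside of it finitely many factors are
    split off first. *)
Lemma qpoch_inf_neq0 (q : R) (y : C) :
  (0 < q < 1)%R -> (forall n, 1 - y * RtoC (q ^ n) <> 0) -> qpoch_inf q y <> 0.
Proof.
intros hq Hy.
assert (Hdisk : forall v, (Cmod v < 1)%R -> qpoch_inf q v <> 0).
{ intros v Hv H0.
  assert (Hv' : (Cmod (v * 1) < 1)%R) by now rewrite Cmult_1_r.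
  destruct (abs_summable_csum _ (qbin_abs_summable q v 0 1 hq Hv')) as [g Hg].
  assert (E := qbinomial_mult q v 0 1 g hq Hv' Hg).
  rewrite Cmult_1_r, H0, !Cmult_0_l, qpoch_inf_0 in E by exact hq.
  now apply C1_nz. }
destruct (qpow_small q y hq) as [n Hn].
rewrite (qpoch_inf_split q y n hq).
apply Cmult_neq_0; [now apply qpoch_neq0 | now apply Hdisk].
Qed.

Lemma qpoch_inf_disk_neq0 (q : R) (y : C) :
  (0 < q < 1)%R -> (Cmod y < 1)%R -> qpoch_inf q y <> 0.
Proof.
intros hq Hy; apply qpoch_inf_neq0; auto.
intros n; apply one_minus_neq0.
eapply Rle_lt_trans; [now apply Cmod_qpow_le | exact Hy].
Qed.

Lemma qbinomial (q : R) (a b u : C) :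
  (0 < q < 1)%R -> (Cmod (a * u) < 1)%R ->
  csum (fun m => qbin q a b m * u ^ m) (qpoch_inf q (b * u) / qpoch_inf q (a * u)).
Proof.
intros hq hu.
destruct (abs_summable_csum _ (qbin_abs_summable q a b u hq hu)) as [g Hg].
replace (qpoch_inf q (b * u) / qpoch_inf q (a * u)) with g; [exact Hg|].
rewrite <- (qbinomial_mult q a b u g hq hu Hg). field.
now apply qpoch_inf_disk_neq0.
Qed.

Lemma euler_qbinomial (q : R) (u : C) :
  (0 < q < 1)%R ->
  csum (fun m => qbin q 0 q m * u ^ m) (qpoch_inf q (RtoC q * u)).
Proof.
intros hq.
replace (qpoch_inf q (RtoC q * u))
  with (qpoch_inf q (RtoC q * u) / qpoch_inf q (0 * u)).
- apply qbinomial; auto. rewrite Cmult_0_l, Cmod_0; lra.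
- rewrite Cmult_0_l, qpoch_inf_0 by exact hq. field.
Qed.

(** * Bilateral series *)

(** The same notion as [is_biseries] with values in any normed module, so that
    shift invariance is available for a complex series and for the real series
    of its absolute values. *)
Definition bisum {K : AbsRing} {V : NormedModule K} (u : Z -> V) (l : V) : Prop :=
  exists l1 l2 : V,
    is_series (fun n : nat => u (Z.of_nat n)) l1 /\
    is_series (fun n : nat => u (- Z.of_nat (S n))%Z) l2 /\
    l = plus l1 l2.

Lemma Z_step_ind (P : Z -> Prop) :
  P 0%Z -> (forall n, P n <-> P (n + 1)%Z) -> forall n, P n.
Proof.
intros H0 H; apply Z.peano_ind; auto.
- intros n Hn; exact (proj1 (H n) Hn).
- intros n Hn; apply H; now replace (Z.pred n + 1)%Z with n by lia.
Qed.

Lemma plus_opp_cancel {K : AbsRing} {V : NormedModule K} (x y : V) :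
  plus (plus x (opp y)) y = x /\ plus (plus x y) (opp y) = x.
Proof.
split; rewrite <- plus_assoc; etransitivity; [| apply plus_zero_r | | apply plus_zero_r];
  f_equal; [apply (plus_opp_l y) | apply (plus_opp_r y)].
Qed.

Lemma bisum_ext {K : AbsRing} {V : NormedModule K} (u v : Z -> V) (l : V) :
  (forall n, u n = v n) -> bisum u l -> bisum v l.
Proof.
intros H (l1 & l2 & H1 & H2 & ->); exists l1, l2; repeat split.
- apply is_series_ext with (2 := H1); intros n; apply H.
- apply is_series_ext with (2 := H2); intros n; apply H.
Qed.

Lemma bisum_succ {K : AbsRing} {V : NormedModule K} (u : Z -> V) (l : V) :
  bisum u l -> bisum (fun n => u (n + 1)%Z) l.
Proof.
intros (l1 & l2 & H1 & H2 & ->).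
exists (plus l1 (opp (u 0%Z))), (plus l2 (u 0%Z)); repeat split.
- apply is_series_ext with (fun n => u (Z.of_nat (S n))).
  + intros n; f_equal; lia.
  + apply (is_series_incr_1 (fun n => u (Z.of_nat n))).
    exact (eq_ind_r (is_series _) H1 (proj1 (plus_opp_cancel l1 (u 0%Z)))).
- apply is_series_decr_1.
  refine (eq_ind_r (is_series _) _ (proj2 (plus_opp_cancel l2 (u 0%Z)))).
  apply is_series_ext with (2 := H2); intros n; f_equal; lia.
- rewrite (plus_comm l2), plus_assoc. apply (f_equal (fun t => plus t l2)).
  symmetry; exact (proj1 (plus_opp_cancel l1 (u 0%Z))).
Qed.

Lemma bisum_pred {K : AbsRing} {V : NormedModule K} (u : Z -> V) (l : V) :
  bisum u l -> bisum (fun n => u (n - 1)%Z) l.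
Proof.
intros (l1 & l2 & H1 & H2 & ->).
exists (plus l1 (u (-1)%Z)), (plus l2 (opp (u (-1)%Z))); repeat split.
- apply is_series_decr_1.
  refine (eq_ind_r (is_series _) _ (proj2 (plus_opp_cancel l1 (u (-1)%Z)))).
  apply is_series_ext with (2 := H1); intros n; f_equal; lia.
- apply is_series_ext with (fun n => u (- Z.of_nat (S (S n)))%Z).
  + intros n; f_equal; lia.
  + apply (is_series_incr_1 (fun n => u (- Z.of_nat (S n))%Z)).
    exact (eq_ind_r (is_series _) H2 (proj1 (plus_opp_cancel l2 (u (-1)%Z)))).
- rewrite (plus_comm l2), plus_assoc. apply (f_equal (fun t => plus t l2)).
  symmetry; exact (proj2 (plus_opp_cancel l1 (u (-1)%Z))).
Qed.

Lemma bisum_shift {K : AbsRing} {V : NormedModule K} (u : Z -> V) (l : V) (s : Z) :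
  bisum u l -> bisum (fun n => u (n + s)%Z) l.
Proof.
revert s; apply (Z_step_ind (fun s => bisum u l -> bisum (fun n => u (n + s)%Z) l)).
- apply bisum_ext; intros n; f_equal; lia.
- intros s; split; intros H Hu.
  + apply bisum_ext with (2 := bisum_succ _ _ (H Hu)); intros n; f_equal; lia.
  + apply bisum_ext with (2 := bisum_pred _ _ (H Hu)); intros n; f_equal; lia.
Qed.

Lemma is_biseries_ext (u v : Z -> C) (l : C) :
  (forall n, u n = v n) -> is_biseries u l -> is_biseries v l.
Proof. exact (bisum_ext (V := C_NormedModule) u v l). Qed.

Lemma is_biseries_scal (c : C) (u : Z -> C) (l : C) :
  is_biseries u l -> is_biseries (fun n => c * u n) (c * l).
Proof.
intros (l1 & l2 & H1 & H2 & ->); exists (c * l1), (c * l2); repeat split.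
- now apply csum_scal.
- now apply (csum_scal c (fun n => u (- Z.of_nat (S n))%Z)).
- ring.
Qed.

Lemma is_biseries_unique (u : Z -> C) (l m : C) :
  is_biseries u l -> is_biseries u m -> l = m.
Proof.
intros (l1 & l2 & H1 & H2 & ->) (m1 & m2 & K1 & K2 & ->).
now rewrite (csum_unique _ _ _ H1 K1), (csum_unique _ _ _ H2 K2).
Qed.

Definition bi_abs_summable (g : Z -> C) : Prop :=
  abs_summable (fun n => g (Z.of_nat n)) /\
  abs_summable (fun n => g (- Z.of_nat (S n))%Z).

Lemma bi_abs_summable_biseries (g : Z -> C) :
  bi_abs_summable g -> exists l, is_biseries g l.
Proof.
intros [H1 H2].
destruct (abs_summable_csum _ H1) as [l1 K1].
destruct (abs_summable_csum _ H2) as [l2 K2].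
exists (l1 + l2), l1, l2; auto.
Qed.

(** The total mass of |g| bounds the partial sums over each half-line,
    wherever the origin is put. *)
Lemma bi_abs_summable_bound (g : Z -> C) :
  bi_abs_summable g ->
  exists G : R, forall (s : Z) (n : nat),
    (sum_n (fun k => Cmod (g (Z.of_nat k + s)%Z)) n <= G)%R /\
    (sum_n (fun k => Cmod (g (- Z.of_nat (S k) + s)%Z)) n <= G)%R.
Proof.
intros [H1 H2].
assert (HG : bisum (V := R_NormedModule) (fun n => Cmod (g n))
  (Series (fun n => Cmod (g (Z.of_nat n)))
   + Series (fun n => Cmod (g (- Z.of_nat (S n))%Z)))%R).
{ eexists _, _; repeat split; apply Series_correct; auto. }
set (G := (_ + _)%R) in HG. exists G; intros s n.
destruct (bisum_shift _ _ s HG) as (l1 & l2 & K1 & K2 & E).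
change (G = l1 + l2)%R in E.
assert (P1 : forall k, (sum_n (fun k => Cmod (g (Z.of_nat k + s)%Z)) k <= l1)%R).
{ intros k; rewrite <- (is_series_unique _ _ K1).
  apply (sum_n_le_Series (fun k => Cmod (g (Z.of_nat k + s)%Z))).
  - intros; apply Cmod_ge_0.
  - now exists l1. }
assert (P2 : forall k, (sum_n (fun k => Cmod (g (- Z.of_nat (S k) + s)%Z)) k <= l2)%R).
{ intros k; rewrite <- (is_series_unique _ _ K2).
  apply (sum_n_le_Series (fun k => Cmod (g (- Z.of_nat (S k) + s)%Z))).
  - intros; apply Cmod_ge_0.
  - now exists l2. }
assert (Q1 := P1 O); assert (Q2 := P2 O); rewrite sum_O in Q1, Q2.
assert (R1 := Cmod_ge_0 (g (Z.of_nat 0 + s)%Z)).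
assert (R2 := Cmod_ge_0 (g (- Z.of_nat 1 + s)%Z)).
specialize (P1 n); specialize (P2 n). split; lra.
Qed.

Lemma sum_n_Cmod_scal (c : C) (u : nat -> C) (n : nat) :
  sum_n (fun k => Cmod (c * u k)) n = (Cmod c * sum_n (fun k => Cmod (u k)) n)%R.
Proof.
rewrite <- (sum_n_mult_l (K := R_Ring)). apply sum_n_ext; intros k; apply Cmod_mult.
Qed.

(** Because bilateral sums are shift invariant, each term [c m] multiplies the
    same total [lg], whatever the shifts [s m]. *)
Lemma biseries_convolution (c : nat -> C) (g w : Z -> C) (s : nat -> Z) (lc lg : C) :
  abs_summable c -> csum c lc ->
  bi_abs_summable g -> is_biseries g lg ->
  (forall n, csum (fun m => c m * g (n + s m)%Z) (w n)) ->
  is_biseries w (lc * lg).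
Proof.
intros Hc Hlc Hg Hlg Hw.
destruct (bi_abs_summable_bound g Hg) as [G HG].
destruct (ClassicalEpsilon.choice
  (fun (m : nat) (p : C * C) =>
     csum (fun n => g (Z.of_nat n + s m)%Z) (fst p) /\
     csum (fun n => g (- Z.of_nat (S n) + s m)%Z) (snd p) /\
     lg = fst p + snd p)) as [p Hp].
{ intros m.
  destruct (bisum_shift (V := C_NormedModule) g lg (s m) Hlg)
    as (l1 & l2 & H1 & H2 & E).
  now exists (l1, l2). }
assert (HcG : ex_series (fun m => Cmod (c m) * G)%R)
  by exact (ex_series_scal_r G _ Hc).
assert (Hhalf : forall (e : nat -> Z) (r : nat -> C),
  (forall m n, (sum_n (fun k => Cmod (g (e k + s m)%Z)) n <= G)%R) ->
  (forall m, csum (fun n => g (e n + s m)%Z) (r m)) ->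
  exists T : C, csum (fun m => c m * r m) T /\ csum (fun n => w (e n)) T).
{ intros e r He Hr.
  destruct (abs_summable_csum (fun m => c m * r m)) as [T HT].
  { apply abs_summable_le with (2 := HcG); intros m; rewrite Cmod_mult.
    apply Rmult_le_compat_l; [apply Cmod_ge_0|].
    apply tends_Cmod_le with (2 := proj1 (csum_tends _ _) (Hr m)).
    intros n; eapply Rle_trans; [apply Cmod_sum_n_le | apply He]. }
  exists T; split; auto.
  apply series_swap with (u := fun m n => c m * g (e n + s m)%Z)
    (A := fun m => (Cmod (c m) * G)%R) (r := fun m => c m * r m); auto.
  - intros m n; rewrite (sum_n_Cmod_scal (c m) (fun k => g (e k + s m)%Z)).
    apply Rmult_le_compat_l; [apply Cmod_ge_0 | apply He].
  - intros m; apply csum_scal, Hr. }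
destruct (Hhalf Z.of_nat (fun m => fst (p m))) as [T1 [HT1 HW1]];
  [intros; apply HG | intros; apply Hp |].
destruct (Hhalf (fun n => - Z.of_nat (S n))%Z (fun m => snd (p m))) as [T2 [HT2 HW2]];
  [intros; apply HG | intros; apply Hp |].
exists T1, T2; repeat split; auto.
apply csum_unique with (fun m => c m * lg).
- rewrite Cmult_comm. apply csum_ext with (2 := csum_scal lg _ _ Hlc).
  intros m; apply Cmult_comm.
- apply csum_ext with (2 := csum_plus _ _ _ _ HT1 HT2); intros m.
  destruct (Hp m) as (_ & _ & ->). ring.
Qed.

(** * Integral powers *)

Lemma Cpowz_nat (z : C) (n : nat) : Cpowz z (Z.of_nat n) = z ^ n.
Proof. destruct n; [easy|]. simpl Cpowz. now rewrite SuccNat2Pos.id_succ. Qed.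

Lemma Cpowz_opp_nat (z : C) (n : nat) : Cpowz z (- Z.of_nat n) = / z ^ n.
Proof.
destruct n; simpl; [field|].
now rewrite Pos2Nat.inj_succ || rewrite SuccNat2Pos.id_succ.
Qed.

Lemma Cpowz_succ (z : C) (n : Z) : z <> 0 -> Cpowz z (n + 1) = z * Cpowz z n.
Proof.
intros Hz; destruct (Z_le_gt_dec 0 n) as [Hn|Hn].
- replace n with (Z.of_nat (Z.to_nat n)) by lia.
  replace (Z.of_nat (Z.to_nat n) + 1)%Z with (Z.of_nat (S (Z.to_nat n))) by lia.
  now rewrite !Cpowz_nat.
- set (k := Z.to_nat (- n - 1)).
  replace (n + 1)%Z with (- Z.of_nat k)%Z by lia.
  replace n with (- Z.of_nat (S k))%Z by lia.
  rewrite !Cpowz_opp_nat; simpl. pose proof (Cpow_nz z k Hz). field. auto.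
Qed.

Lemma Cpowz_add (z : C) (n m : Z) :
  z <> 0 -> Cpowz z (n + m) = Cpowz z n * Cpowz z m.
Proof.
intros Hz; revert m; apply Z_step_ind.
- rewrite Z.add_0_r; simpl; ring.
- intros m; rewrite Z.add_assoc, !Cpowz_succ by exact Hz; split; intros H.
  + rewrite H; ring.
  + transitivity (/ z * (z * Cpowz z (n + m))); [field; exact Hz|].
    rewrite H; field; exact Hz.
Qed.

Lemma Cpowz_neq0 (z : C) (n : Z) : z <> 0 -> Cpowz z n <> 0.
Proof.
intros Hz H.
assert (E : Cpowz z (n + - n) = 0) by (rewrite Cpowz_add, H by exact Hz; ring).
rewrite Z.add_opp_diag_r in E; now apply C1_nz.
Qed.

Lemma Cpowz_RtoC (q : R) (n : Z) : q <> 0%R -> RtoC (powerRZ q n) = Cpowz (RtoC q) n.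
Proof.
intros Hq; assert (Hq' := RtoC_neq0 q Hq).
revert n; apply Z_step_ind; [easy|].
intros n; rewrite powerRZ_add, RtoC_mult, Cpowz_succ by assumption.
change (powerRZ q 1) with (q * 1)%R; rewrite Rmult_1_r.
split; intros H.
- rewrite H; ring.
- transitivity (/ RtoC q * (RtoC (powerRZ q n) * RtoC q)); [field; exact Hq'|].
  rewrite H; field; exact Hq'.
Qed.

Lemma RtoC_q_neq0 (q : R) : (0 < q < 1)%R -> RtoC q <> 0.
Proof. intros hq; apply RtoC_neq0; lra. Qed.

Lemma Cpowz_qpow (q : R) (n : nat) : Cpowz (RtoC q) (Z.of_nat n) = RtoC (q ^ n).
Proof. now rewrite Cpowz_nat, RtoC_pow. Qed.

Lemma Cpowz_opp (z : C) (n : Z) : z <> 0 -> Cpowz z (- n) = / Cpowz z n.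
Proof.
intros Hz; pose proof (Cpowz_neq0 z n Hz) as Hn.
transitivity (Cpowz z (- n) * Cpowz z n * / Cpowz z n); [field; exact Hn|].
rewrite <- Cpowz_add by exact Hz. replace (- n + n)%Z with 0%Z by lia.
simpl; ring.
Qed.

(** * Theta series *)

(** The integer division is exact, n (n - 1) being even. *)
Definition theta_term (q : R) (y : C) (n : Z) : C :=
  Cpowz (- y) n * Cpowz (RtoC q) (n * (n - 1) / 2).

Lemma Copp_neq0 (y : C) : y <> 0 -> - y <> 0.
Proof.
intros Hy H; apply Hy. replace y with (- - y) by ring; rewrite H; ring.
Qed.

Lemma theta_term_succ (q : R) (y : C) (n : Z) :
  (0 < q < 1)%R -> y <> 0 ->
  theta_term q y (n + 1) = - y * Cpowz (RtoC q) n * theta_term q y n.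
Proof.
intros hq Hy; unfold theta_term.
replace ((n + 1) * (n + 1 - 1))%Z with (n * (n - 1) + n * 2)%Z by ring.
rewrite Z.div_add by lia.
rewrite (Cpowz_succ (- y)) by now apply Copp_neq0.
rewrite Cpowz_add by now apply RtoC_q_neq0. ring.
Qed.

Lemma theta_term_0 (q : R) (y : C) : theta_term q y 0 = 1.
Proof. unfold theta_term; simpl; ring. Qed.

Lemma theta_term_pred (q : R) (y : C) (n : Z) :
  (0 < q < 1)%R -> y <> 0 ->
  theta_term q y (n - 1) = - (RtoC q / (y * Cpowz (RtoC q) n)) * theta_term q y n.
Proof.
intros hq Hy.
assert (Hq := RtoC_q_neq0 q hq). assert (Hn := Cpowz_neq0 _ (n - 1) Hq).
replace n with (n - 1 + 1)%Z at 2 3 by lia.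
rewrite theta_term_succ, Cpowz_succ by auto. field. auto.
Qed.

Lemma theta_term_scal (q : R) (y z : C) (n : Z) :
  (0 < q < 1)%R -> y <> 0 -> z <> 0 ->
  theta_term q (y * z) n = Cpowz z n * theta_term q y n.
Proof.
intros hq Hy Hz; assert (Hyz := Cmult_neq_0 _ _ Hy Hz).
assert (Hq := RtoC_q_neq0 q hq).
revert n; apply Z_step_ind.
- rewrite !theta_term_0; simpl; ring.
- intros n; rewrite !theta_term_succ, Cpowz_succ by auto.
  pose proof (Cpowz_neq0 _ n Hq).
  split; intros E.
  + rewrite E; ring.
  + transitivity (- y * z * Cpowz (RtoC q) n * theta_term q (y * z) n
                  / (- y * z * Cpowz (RtoC q) n)); [field; auto|].
    transitivity (- (y * z) * Cpowz (RtoC q) n * theta_term q (y * z) n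
                  / (- y * z * Cpowz (RtoC q) n)); [field; auto|].
    rewrite E; field; auto.
Qed.

Lemma theta_term_bi_abs_summable (q : R) (y : C) :
  (0 < q < 1)%R -> y <> 0 -> bi_abs_summable (theta_term q y).
Proof.
intros hq Hy; assert (Hq := RtoC_q_neq0 q hq); split.
- apply ratio_test with (rho := fun n => (Cmod y * q ^ n)%R) (L := (Cmod y * 0)%R);
    [| |lra].
  + intros n; rewrite Nat2Z.inj_succ; unfold Z.succ.
    rewrite theta_term_succ, Cpowz_qpow by auto. rewrite !Cmod_mult, Cmod_opp.
    rewrite Cmod_RtoC_pos by (apply pow_le; lra). apply Rle_refl.
  + apply is_lim_seq_mult'; [apply is_lim_seq_const | now apply qpow_lim].
- apply ratio_test
    with (rho := fun n => (Cmod (RtoC q / y) * q ^ S n)%R)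
         (L := (Cmod (RtoC q / y) * 0)%R); [| |lra].
  + intros n.
    replace (- Z.of_nat (S (S n)))%Z with (- Z.of_nat (S n) - 1)%Z by lia.
    rewrite theta_term_pred, Cpowz_opp, Cpowz_qpow by auto.
    rewrite Cmod_mult, Cmod_opp.
    apply Rmult_le_compat_r; [apply Cmod_ge_0|]. right.
    transitivity (Cmod (RtoC q / y * RtoC (q ^ S n))).
    * f_equal.
      assert (RtoC (q ^ S n) <> 0) by (apply RtoC_neq0, pow_nonzero; lra).
      field. auto.
    * rewrite Cmod_mult. f_equal. apply Cmod_RtoC_pos, pow_le; lra.
  + apply is_lim_seq_mult'; [apply is_lim_seq_const|].
    apply (is_lim_seq_incr_1 (fun n => q ^ n)%R). now apply qpow_lim.
Qed.

(** Completing the square: the exponents n(n-1)/2 of a theta series and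
    m(m+1)/2 of Euler's series combine into the exponent for n - m. *)
Lemma theta_term_sub (q : R) (y z : C) (n : Z) (m : nat) :
  (0 < q < 1)%R -> y <> 0 ->
  qbin q 1 0 m * z ^ m * theta_term q y (n + - Z.of_nat m) =
  theta_term q y n
  * (qbin q 0 (RtoC q) m * (z / (y * Cpowz (RtoC q) n)) ^ m).
Proof.
intros hq Hy; assert (Hq := RtoC_q_neq0 q hq).
assert (Hn := Cpowz_neq0 _ n Hq).
induction m as [|m IH].
- simpl; rewrite Z.add_0_r; ring.
- pose proof (one_minus_qpow_S_neq0 q m hq) as H1.
  replace (n + - Z.of_nat (S m))%Z with (n + - Z.of_nat m - 1)%Z by lia.
  rewrite theta_term_pred, Cpowz_add, Cpowz_opp, Cpowz_qpow by auto.
  assert (Hm : RtoC (q ^ m) <> 0) by (apply RtoC_neq0, pow_nonzero; lra).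
  change (qbin q 1 0 (S m))
    with (qbin q 1 0 m * (1 - 0 * RtoC (q ^ m)) / (1 - RtoC (q ^ S m))).
  change (qbin q 0 (RtoC q) (S m))
    with (qbin q 0 (RtoC q) m * (0 - RtoC q * RtoC (q ^ m)) / (1 - RtoC (q ^ S m))).
  simpl Cpow.
  transitivity (qbin q 1 0 m * z ^ m * theta_term q y (n + - Z.of_nat m)
    * ((0 - RtoC q * RtoC (q ^ m)) / (1 - RtoC (q ^ S m))
       * (z / (y * Cpowz (RtoC q) n)))); [field; auto|].
  rewrite IH. field; auto.
Qed.

(** Multiplying a theta series by Euler's expansion of 1/(z; q)_inf and
    collecting the multiples of each theta term. *)
Lemma theta_over_qpoch (q : R) (y z J : C) :
  (0 < q < 1)%R -> y <> 0 -> (Cmod z < 1)%R ->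
  is_biseries (theta_term q y) J ->
  is_biseries
    (fun n => theta_term q y n
       * qpoch_inf q (RtoC q * (z / (y * Cpowz (RtoC q) n))))
    (J / qpoch_inf q z).
Proof.
intros hq Hy Hz HJ.
assert (Hz1 : (Cmod (1 * z) < 1)%R) by now rewrite Cmult_1_l.
assert (Hz0 := qpoch_inf_disk_neq0 q z hq Hz).
replace (J / qpoch_inf q z)
  with (qpoch_inf q (0 * z) / qpoch_inf q (1 * z) * J).
- apply biseries_convolution
    with (c := fun m => qbin q 1 0 m * z ^ m) (g := theta_term q y)
         (s := fun m => (- Z.of_nat m)%Z); auto.
  + now apply qbin_abs_summable.
  + now apply qbinomial.
  + now apply theta_term_bi_abs_summable.
  + intros n.
    apply csum_ext with (2 := csum_scal (theta_term q y n) _ _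
      (euler_qbinomial q (z / (y * Cpowz (RtoC q) n)) hq)).
    intros m; now rewrite theta_term_sub.
- rewrite Cmult_0_l, Cmult_1_l, qpoch_inf_0 by exact hq. field; exact Hz0.
Qed.

(** The theta function without its factor (q; q)_inf. *)
Definition theta (q : R) (y : C) : C := qpoch_inf q y * qpoch_inf q (RtoC q / y).

Lemma theta_shift (q : R) (y : C) :
  (0 < q < 1)%R -> y <> 0 -> theta q y = - y * theta q (y * RtoC q).
Proof.
intros hq Hy; assert (Hq := RtoC_q_neq0 q hq); unfold theta.
rewrite (qpoch_inf_succ q y), (qpoch_inf_succ q (RtoC q / (y * RtoC q))) by exact hq.
replace (RtoC q / (y * RtoC q) * RtoC q) with (RtoC q / y) by (field; auto).
field; auto.
Qed.

(** [theta_shift] iterated in both directions. *)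
Lemma theta_quasiperiodic (q : R) (y : C) (n : Z) :
  (0 < q < 1)%R -> y <> 0 ->
  theta q y = theta_term q y n * theta q (y * Cpowz (RtoC q) n).
Proof.
intros hq Hy; assert (Hq := RtoC_q_neq0 q hq).
revert n; apply Z_step_ind.
- rewrite theta_term_0; simpl; rewrite Cmult_1_r; ring.
- intros n.
  assert (Hn := Cmult_neq_0 _ _ Hy (Cpowz_neq0 _ n Hq)).
  assert (E : theta_term q y n * theta q (y * Cpowz (RtoC q) n) =
              theta_term q y (n + 1) * theta q (y * Cpowz (RtoC q) (n + 1))).
  { rewrite (theta_shift q (y * Cpowz (RtoC q) n)), theta_term_succ by auto.
    rewrite Cpowz_succ by auto.
    replace (y * Cpowz (RtoC q) n * RtoC q) with (y * (RtoC q * Cpowz (RtoC q) n))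
      by ring. ring. }
  now rewrite E.
Qed.

Lemma qbin_1_0 (q : R) (m : nat) :
  (0 < q < 1)%R -> qbin q 1 0 m * qpoch q (RtoC q) m = 1.
Proof.
intros hq; induction m as [|m IH]; [simpl; ring|].
pose proof (one_minus_qpow_S_neq0 q m hq) as H. rewrite RtoC_qpow_S in H.
change (qbin q 1 0 (S m))
    with (qbin q 1 0 m * (1 - 0 * RtoC (q ^ m)) / (1 - RtoC (q ^ S m))).
rewrite RtoC_qpow_S; simpl qpoch.
transitivity (qbin q 1 0 m * qpoch q (RtoC q) m); [field; exact H | exact IH].
Qed.

(** For z = y in [theta_over_qpoch] the factor (q^(1-n); q)_inf kills the terms
    with n > 0, and what is left is Euler's series for (q/y; q)_inf. *)
Lemma jacobi_triple_product_disk (q : R) (y J : C) :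
  (0 < q < 1)%R -> y <> 0 -> (Cmod y < 1)%R ->
  is_biseries (theta_term q y) J -> J = qpoch_inf q (RtoC q) * theta q y.
Proof.
intros hq Hy Hy1 HJ; assert (Hq := RtoC_q_neq0 q hq).
assert (H := theta_over_qpoch q y y J hq Hy Hy1 HJ).
assert (K : is_biseries
  (fun n => theta_term q y n
     * qpoch_inf q (RtoC q * (y / (y * Cpowz (RtoC q) n))))
  (qpoch_inf q (RtoC q) * qpoch_inf q (RtoC q / y))).
{ assert (Hterm : forall m,
    qpoch_inf q (RtoC q) * (qbin q 0 (RtoC q) m * (/ y) ^ m) =
    theta_term q y (- Z.of_nat m)
    * qpoch_inf q (RtoC q * (y / (y * Cpowz (RtoC q) (- Z.of_nat m))))).
  { intros m.
    assert (E := theta_term_sub q y 1 0 m hq Hy).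
    rewrite theta_term_0 in E. simpl Cpowz in E.
    replace (1 / (y * 1)) with (/ y) in E by (field; auto).
    rewrite Cmult_1_l in E; rewrite <- E; clear E.
    rewrite (qpoch_inf_split q (RtoC q) m hq).
    rewrite Cpowz_opp, Cpowz_qpow by exact Hq.
    assert (Hm : RtoC (q ^ m) <> 0) by (apply RtoC_neq0, pow_nonzero; lra).
    replace (y / (y * / RtoC (q ^ m))) with (RtoC (q ^ m)) by (field; auto).
    replace (1 ^ m) with (RtoC 1)
      by (clear; induction m as [|m IH]; [reflexivity|]; simpl; rewrite <- IH; now rewrite Cmult_1_l).
    transitivity (qbin q 1 0 m * qpoch q (RtoC q) m
      * (theta_term q y (- Z.of_nat m) * qpoch_inf q (RtoC q * RtoC (q ^ m))));
      [simpl Z.add; ring|].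
    rewrite qbin_1_0 by exact hq; ring. }
  assert (HE := csum_scal (qpoch_inf q (RtoC q)) _ _ (euler_qbinomial q (/ y) hq)).
  exists (qpoch_inf q (RtoC q)),
    (qpoch_inf q (RtoC q) * qpoch_inf q (RtoC q / y) - qpoch_inf q (RtoC q)).
  repeat split; [| |ring].
  - set (u := fun n : nat => _).
    replace (qpoch_inf q (RtoC q)) with (u O); [apply csum_single|].
    +
      (* the product for the index n + 1 contains 1 - q^(-n) q^n = 0 *)
      intros n; unfold u. rewrite Cpowz_qpow.
      assert (Hm : RtoC (q ^ S n) <> 0) by (apply RtoC_neq0, pow_nonzero; lra).
      rewrite (qpoch_inf_split q _ (S n) hq), qpoch_succ_r.
      rewrite RtoC_qpow_S in *. assert (RtoC (q ^ n) <> 0).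
      { intros E; apply Hm; rewrite E; ring. }
      replace (1 - RtoC q * (y / (y * (RtoC q * RtoC (q ^ n)))) * RtoC (q ^ n))
        with (RtoC 0) by (field; auto).
      now rewrite Cmult_0_r, Cmult_0_l, Cmult_0_r.
    + change (u O) with (theta_term q y 0 * qpoch_inf q (RtoC q * (y / (y * 1)))).
      rewrite theta_term_0.
      replace (RtoC q * (y / (y * 1))) with (RtoC q) by (field; auto). ring.
  - apply csum_ext with (1 := fun n => Hterm (S n)).
    replace (qpoch_inf q (RtoC q) * qpoch_inf q (RtoC q / y) - qpoch_inf q (RtoC q))
      with (qpoch_inf q (RtoC q) * qpoch_inf q (RtoC q * / y)
            - qpoch_inf q (RtoC q) * (qbin q 0 (RtoC q) 0 * (/ y) ^ 0))
      by (unfold Cdiv; simpl; ring).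
    exact (csum_incr_1 _ _ HE). }
assert (E := is_biseries_unique _ _ _ H K).
assert (H0 := qpoch_inf_disk_neq0 q y hq Hy1).
unfold theta.
transitivity (J / qpoch_inf q y * qpoch_inf q y); [field; exact H0|].
rewrite E; ring.
Qed.

(** Both sides satisfy the functional equation of [theta_shift], which extends
    the identity from the punctured unit disk to all nonzero y. *)
Lemma jacobi_triple_product (q : R) (y J : C) :
  (0 < q < 1)%R -> y <> 0 ->
  is_biseries (theta_term q y) J -> J = qpoch_inf q (RtoC q) * theta q y.
Proof.
intros hq Hy HJ; assert (Hq := RtoC_q_neq0 q hq).
destruct (qpow_small q y hq) as [n Hn].
revert y J Hy HJ Hn; induction n as [|n IH]; intros y J Hy HJ Hn.
- apply jacobi_triple_product_disk; auto. simpl in Hn; now rewrite Cmult_1_r in Hn.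
- assert (HJ' : is_biseries (theta_term q (y * RtoC q)) (/ (- y) * J)).
  { apply is_biseries_ext with (fun n => / (- y) * theta_term q y (n + 1)).
    - intros k; rewrite theta_term_scal, theta_term_succ by auto.
      field; auto.
    - apply is_biseries_scal. exact (bisum_succ (V := C_NormedModule) _ _ HJ). }
  assert (Hyq := Cmult_neq_0 _ _ Hy Hq).
  specialize (IH (y * RtoC q) _ Hyq HJ').
  rewrite theta_shift by auto.
  transitivity (- y * (/ - y * J)); [field; auto|].
  rewrite IH; [ring|].
  now rewrite RtoC_qpow_S, Cmult_assoc in Hn.
Qed.

(** * The bilateral series of 1/(x; q)_inf *)

Lemma one_minus_qz_shift (q : R) (x : C) (n : Z) :
  (0 < q < 1)%R ->
  (forall k, 1 - x * Cpowz (RtoC q) k <> 0) ->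
  forall m : nat, 1 - x * Cpowz (RtoC q) n * RtoC (q ^ m) <> 0.
Proof.
intros hq Hx m; rewrite <- Cpowz_qpow, <- Cmult_assoc.
rewrite <- Cpowz_add by now apply RtoC_q_neq0. apply Hx.
Qed.

Lemma theta_neq0 (q : R) (x : C) :
  (0 < q < 1)%R -> x <> 0 -> (forall n, 1 - x * Cpowz (RtoC q) n <> 0) ->
  theta q x <> 0.
Proof.
intros hq Hx Hxq; assert (Hq := RtoC_q_neq0 q hq).
apply Cmult_neq_0.
- apply qpoch_inf_neq0; auto.
  assert (H := one_minus_qz_shift q x 0 hq Hxq); simpl in H.
  now rewrite Cmult_1_r in H.
- apply qpoch_inf_neq0; auto; intros n E.
  set (k := (- Z.of_nat (S n))%Z).
  assert (Hqn : RtoC (q ^ S n) <> 0) by (apply RtoC_neq0, pow_nonzero; lra).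
  assert (Hk : Cpowz (RtoC q) k = / RtoC (q ^ S n))
    by (unfold k; now rewrite Cpowz_opp, Cpowz_qpow).
  apply (Hxq k); rewrite Hk.
  transitivity (- (x / RtoC (q ^ S n)) * (1 - RtoC q / x * RtoC (q ^ n))).
  + rewrite RtoC_qpow_S in *. field.
    repeat split; auto; intros F; apply Hqn; rewrite F; ring.
  + rewrite E; ring.
Qed.

Lemma inv_qpoch_bi_abs_summable (q : R) (x z : C) :
  (0 < q < 1)%R -> x <> 0 -> (forall n, 1 - x * Cpowz (RtoC q) n <> 0) ->
  z <> 0 -> (Cmod z < 1)%R ->
  bi_abs_summable (fun n => Cpowz z n / qpoch_inf q (x * Cpowz (RtoC q) n)).
Proof.
intros hq Hx Hxq Hz Hz1; assert (Hq := RtoC_q_neq0 q hq).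
assert (Hnz : forall n, qpoch_inf q (x * Cpowz (RtoC q) n) <> 0).
{ intros n; apply qpoch_inf_neq0, one_minus_qz_shift; auto. }
set (g := fun n => _).
assert (Hg : forall n, g (n + 1)%Z = z * (1 - x * Cpowz (RtoC q) n) * g n).
{ intros n; unfold g. assert (H := Hnz (n + 1)%Z).
  rewrite (qpoch_inf_succ q (x * Cpowz (RtoC q) n)), !Cpowz_succ in * by auto.
  rewrite (Cmult_comm (RtoC q)), Cmult_assoc in *. field. auto. }
split.
- apply ratio_test with (rho := fun n => (Cmod z * (1 + Cmod x * q ^ n))%R)
    (L := (Cmod z * (1 + Cmod x * 0))%R); [| |lra].
  + intros n; rewrite Nat2Z.inj_succ; unfold Z.succ. rewrite Hg, !Cmod_mult.
    apply Rmult_le_compat_r; [apply Cmod_ge_0|].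
    apply Rmult_le_compat_l; [apply Cmod_ge_0|].
    unfold Cminus; eapply Rle_trans; [apply Cmod_triangle|].
    rewrite Cmod_1, Cmod_opp, Cmod_mult, Cpowz_qpow, Cmod_RtoC_pos; [lra|].
    apply pow_le; lra.
  + repeat first [apply is_lim_seq_mult' | apply is_lim_seq_plus'];
      auto using is_lim_seq_const, qpow_lim.
- assert (Hxpos : (0 < Cmod x)%R) by now apply Cmod_gt_0.
  assert (Hzpos : (0 < Cmod z)%R) by now apply Cmod_gt_0.
  apply ratio_test
    with (rho := fun n => (q ^ S (S n) / (Cmod z * Cmod (RtoC (q ^ S (S n)) - x)))%R)
         (L := (0 / (Cmod z * Cmod x))%R).
  + intros n.
    set (k := (- Z.of_nat (S (S n)))%Z).
    replace (- Z.of_nat (S n))%Z with (k + 1)%Z by lia. rewrite Hg.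
    assert (Hk : Cpowz (RtoC q) k = / RtoC (q ^ S (S n)))
      by (unfold k; now rewrite Cpowz_opp, Cpowz_qpow).
    assert (Hqn : (0 < q ^ S (S n))%R) by (apply pow_lt; lra).
    assert (Hqn' : RtoC (q ^ S (S n)) <> 0) by (apply RtoC_neq0; lra).
    assert (Hd : RtoC (q ^ S (S n)) - x <> 0).
    { intros E. apply (Hxq k). rewrite Hk.
      replace x with (RtoC (q ^ S (S n))); [field; exact Hqn'|].
      rewrite <- (Cplus_0_r x), <- E; ring. }
    right.
    transitivity (Cmod (RtoC (q ^ S (S n)) / (z * (RtoC (q ^ S (S n)) - x))
                        * (z * (1 - x * Cpowz (RtoC q) k) * g k))).
    * f_equal. rewrite Hk. field. auto.
    * rewrite Cmod_mult, Cmod_div, (Cmod_mult z) by now apply Cmult_neq_0.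
      rewrite Cmod_RtoC_pos by lra. reflexivity.
  + apply is_lim_seq_div'.
    * apply (is_lim_seq_incr_1 (fun n => q ^ S n)%R).
      apply (is_lim_seq_incr_1 (fun n => q ^ n)%R). now apply qpow_lim.
    * apply is_lim_seq_mult'; [apply is_lim_seq_const|].
      replace (Cmod x) with (Cmod (0 - x)) by (rewrite <- (Cmod_opp x); f_equal; ring).
      apply (is_lim_seq_incr_1 (fun n => Cmod (RtoC (q ^ S n) - x))).
      apply (is_lim_seq_incr_1 (fun n => Cmod (RtoC (q ^ n) - x))).
      apply (filterlim_comp _ _ _ _ (fun c : C => norm (K := C_AbsRing) c) _
        (locally (T := C_NormedModule) (0 - x))).
      -- apply tends_filterlim, tends_plus; [|apply tends_const].
         apply tends_ext with (2 := tends_qpow q 1 hq); intros; ring.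
      -- apply (filterlim_norm (V := C_NormedModule)).
    * assert (0 < Cmod z * Cmod x)%R by now apply Rmult_lt_0_compat. lra.
  + unfold Rdiv; rewrite Rmult_0_l; lra.
Qed.

(** The case of no parameters: Ramanujan's 1psi1 sum with vanishing lower
    parameter. The theta function turns 1/(x q^n; q)_inf into
    (q^(1-n)/x; q)_inf, and [theta_over_qpoch] applies. *)
Lemma inv_qpoch_biseries (q : R) (x z : C) :
  (0 < q < 1)%R -> x <> 0 -> (forall n, 1 - x * Cpowz (RtoC q) n <> 0) ->
  z <> 0 -> (Cmod z < 1)%R ->
  is_biseries (fun n => Cpowz z n / qpoch_inf q (x * Cpowz (RtoC q) n))
    (qpoch_inf q (RtoC q) * theta q (x * z) / (theta q x * qpoch_inf q z)).
Proof.
intros hq Hx Hxq Hz Hz1; assert (Hq := RtoC_q_neq0 q hq).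
assert (Hxz := Cmult_neq_0 _ _ Hx Hz).
assert (Hxn : forall n, x * Cpowz (RtoC q) n <> 0)
  by (intros; apply Cmult_neq_0; auto using Cpowz_neq0).
assert (Hnz : forall n, qpoch_inf q (x * Cpowz (RtoC q) n) <> 0).
{ intros n; apply qpoch_inf_neq0, one_minus_qz_shift; auto. }
assert (Hth := theta_neq0 q x hq Hx Hxq).
assert (Hz0 := qpoch_inf_disk_neq0 q z hq Hz1).
destruct (bi_abs_summable_biseries _ (theta_term_bi_abs_summable q (x * z) hq Hxz))
  as [J HJ].
assert (H := theta_over_qpoch q (x * z) z J hq Hxz Hz1 HJ).
rewrite (jacobi_triple_product q (x * z) J hq Hxz HJ) in H.
replace (qpoch_inf q (RtoC q) * theta q (x * z) / (theta q x * qpoch_inf q z))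
  with (/ theta q x * (qpoch_inf q (RtoC q) * theta q (x * z) / qpoch_inf q z))
  by (field; auto).
apply is_biseries_ext with (2 := is_biseries_scal (/ theta q x) _ _ H).
intros n.
rewrite (theta_quasiperiodic q x n) by auto.
rewrite theta_term_scal by auto.
assert (Hth' : theta q (x * Cpowz (RtoC q) n) <> 0).
{ intros E; apply Hth; rewrite (theta_quasiperiodic q x n), E by auto; ring. }
assert (Ht : theta_term q x n <> 0).
{ intros E; apply Hth; rewrite (theta_quasiperiodic q x n), E by auto; ring. }
specialize (Hnz n). specialize (Hxn n).
assert (Hn := Cpowz_neq0 _ n Hq).
unfold theta in *.
replace (RtoC q * (z / (x * z * Cpowz (RtoC q) n)))
  with (RtoC q / (x * Cpowz (RtoC q) n)) by (field; auto).
assert (qpoch_inf q (RtoC q / (x * Cpowz (RtoC q) n)) <> 0).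
{ intros E; apply Hth'; rewrite E; ring. }
field. auto.
Qed.

(** * Convolution of coefficient sequences *)

Definition convolution (d e : nat -> C) (n : nat) : C :=
  sum_n (fun i => d i * e (n - i)%nat) n.

Lemma sum_n_C_shift (v : nat -> C) (n : nat) :
  sum_n v (S n) = v O + sum_n (fun k => v (S k)) n :> C.
Proof.
induction n as [|n IH].
- now rewrite sum_n_C, !sum_O.
- rewrite sum_n_C, IH, (sum_n_C (fun k => v (S k))); ring.
Qed.

Lemma csum_finite_support (v : nat -> C) (n : nat) :
  (forall i, (n < i)%nat -> v i = 0) -> csum v (sum_n v n).
Proof.
revert v; induction n as [|n IH]; intros v Hv.
- rewrite sum_O; apply csum_single; intros i; apply Hv; lia.
- rewrite sum_n_C_shift; apply csum_decr_1, IH; intros i Hi; apply Hv; lia.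
Qed.

(** Placing row i of a double series on the antidiagonals delays it by i. *)
Lemma csum_delay (v : nat -> C) (l : C) (i : nat) :
  csum v l -> csum (fun n => if (i <=? n)%nat then v (n - i)%nat else RtoC 0) l.
Proof.
intros Hv; induction i as [|i IH].
- apply csum_ext with (2 := Hv); intros n; now rewrite Nat.sub_0_r.
- rewrite <- (Cplus_0_l l).
  exact (csum_decr_1
    (fun n => if (S i <=? n)%nat then v (n - S i)%nat else RtoC 0) l IH).
Qed.

Lemma abs_summable_delay (v : nat -> C) (i n : nat) :
  abs_summable v ->
  (sum_n (fun k => Cmod (if (i <=? k)%nat then v (k - i)%nat else RtoC 0)) n
   <= Series (fun k => Cmod (v k)))%R.
Proof.
intros Hv; revert n; induction i as [|i IH]; intros n.
- apply Rle_trans with (sum_n (fun k => Cmod (v k)) n).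
  + right; apply sum_n_ext; intros k; now rewrite Nat.sub_0_r.
  + apply (sum_n_le_Series (fun k => Cmod (v k))); auto.
    intros; apply Cmod_ge_0.
- assert (H0 := Rle_trans _ _ _ (eq_ind_r (fun r => 0 <= r)%R (Cmod_ge_0 _)
    (sum_O (fun k => Cmod (if (i <=? k)%nat then v (k - i)%nat else RtoC 0)))) (IH O)).
  destruct n as [|n].
  + rewrite sum_O; simpl; now rewrite Cmod_0.
  + apply Rle_trans with (2 := IH n). right.
    unfold sum_n at 1; rewrite sum_n_m_Reals by lia.
    unfold sum_n; rewrite sum_n_m_Reals by lia.
    clear; induction n as [|n IH].
    * unfold sum_f; simpl. rewrite Cmod_0; ring.
    * unfold sum_f in *. rewrite !Nat.sub_0_r in *.
      rewrite tech5, IH, (tech5 _ n), !Nat.add_0_r. reflexivity.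
Qed.

Lemma convolution_abs_summable (d e : nat -> C) :
  abs_summable d -> abs_summable e -> abs_summable (convolution d e).
Proof.
intros Hd He.
apply abs_summable_le
  with (fun n => sum_f_R0 (fun k => Cmod (d k) * Cmod (e (n - k)%nat))%R n).
- intros n; rewrite <- sum_n_Reals.
  eapply Rle_trans; [apply Cmod_sum_n_le|].
  right; apply sum_n_ext; intros k; apply Cmod_mult.
- eexists; apply (is_series_mult_pos (fun n => Cmod (d n)) (fun n => Cmod (e n)));
    [exact (Series_correct _ Hd) | exact (Series_correct _ He) | |];
    intros; apply Cmod_ge_0.
Qed.

(** Summing a convolution against a bounded function of the index, antidiagonal
    by antidiagonal or row by row. *)
Lemma convolution_csum (d e g r : nat -> C) (B : R) :
  abs_summable d -> abs_summable e -> (forall n, Cmod (g n) <= B)%R ->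
  (forall i, csum (fun m => e m * g (i + m)%nat) (r i)) ->
  exists T : C, csum (fun i => d i * r i) T /\
                csum (fun n => convolution d e n * g n) T.
Proof.
intros Hd He Hg Hr.
set (E := Series (fun k => Cmod (e k))).
assert (HEB : ex_series (fun m => Cmod (d m) * (E * B))%R)
  by exact (ex_series_scal_r (E * B)%R _ Hd).
assert (Hsum : forall i n,
  (sum_n (fun k => Cmod (if (i <=? k)%nat then d i * (e (k - i)%nat * g k) else RtoC 0)) n
   <= Cmod (d i) * (E * B))%R).
{ intros i n.
  apply Rle_trans with (sum_n (fun k => (Cmod (d i) * B)
     * Cmod (if (i <=? k)%nat then e (k - i)%nat else RtoC 0))%R n).
  - apply sum_n_m_le; intros k. destruct (i <=? k)%nat.
    + rewrite !Cmod_mult.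
      assert (Cmod (e (k - i)%nat) * Cmod (g k) <= Cmod (e (k - i)%nat) * B)%R
        by (apply Rmult_le_compat_l; [apply Cmod_ge_0 | apply Hg]).
      assert (0 <= Cmod (d i))%R by apply Cmod_ge_0. nra.
    + rewrite !Cmod_0; lra.
  - rewrite (sum_n_mult_l (K := R_Ring)).
    change (Cmod (d i) * B * sum_n (fun k =>
      Cmod (if (i <=? k)%nat then e (k - i)%nat else RtoC 0)) n
      <= Cmod (d i) * (E * B))%R.
    assert (HB : (0 <= B)%R) by (eapply Rle_trans; [apply Cmod_ge_0 | apply (Hg O)]).
    assert (H := abs_summable_delay e i n He). fold E in H.
    assert (0 <= Cmod (d i) * B)%R by (apply Rmult_le_pos; auto; apply Cmod_ge_0).
    nra. }
assert (Hrow : forall i,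
  csum (fun n => if (i <=? n)%nat then d i * (e (n - i)%nat * g n) else RtoC 0) (d i * r i)).
{ intros i.
  apply csum_ext with (2 := csum_delay _ _ i (csum_scal (d i) _ _ (Hr i))).
  intros n; destruct (Nat.leb_spec i n) as [Hi|Hi]; [|easy].
  now replace (i + (n - i))%nat with n by lia. }
destruct (abs_summable_csum (fun i => d i * r i)) as [T HT].
{ apply abs_summable_le with (2 := HEB); intros i.
  apply tends_Cmod_le with (2 := proj1 (csum_tends _ _) (Hrow i)).
  intros n; eapply Rle_trans; [apply Cmod_sum_n_le | apply Hsum]. }
exists T; split; auto.
refine (series_swap _ _ _ (fun n => convolution d e n * g n) T Hsum HEB Hrow _ HT).
intros n.
replace (convolution d e n * g n) with
  (sum_n (fun i => if (i <=? n)%nat then d i * (e (n - i)%nat * g n) else RtoC 0) n).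
- apply csum_finite_support; intros i Hi.
  destruct (Nat.leb_spec i n); [lia | easy].
- unfold convolution. rewrite <- (sum_n_mult_r (K := C_Ring) (g n)).
  apply sum_n_ext_loc; intros i Hi.
  destruct (Nat.leb_spec i n); [|lia]. apply Cmult_assoc.
Qed.

Lemma convolution_pow (d e : nat -> C) (u : C) (n : nat) :
  convolution (fun m => d m * u ^ m) (fun m => e m * u ^ m) n =
  convolution d e n * u ^ n.
Proof.
unfold convolution. rewrite <- (sum_n_mult_r (K := C_Ring) (u ^ n)).
apply sum_n_ext_loc; intros i Hi.
change (d i * u ^ i * (e (n - i)%nat * u ^ (n - i)) = d i * e (n - i)%nat * u ^ n).
assert (E : u ^ n = u ^ i * u ^ (n - i))
  by (rewrite <- Cpow_add_r; f_equal; lia).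
rewrite E; ring.
Qed.

(** Taylor coefficients in u of the product over the pairs (a, b) of
    (b u; q)_inf / (a u; q)_inf. *)
Fixpoint qbin_prod (q : R) (l : list (C * C)) : nat -> C :=
  match l with
  | [] => fun n => match n with O => 1 | S _ => 0 end
  | p :: l' => convolution (qbin_prod q l') (qbin q (fst p) (snd p))
  end.

Definition qratio (q : R) (l : list (C * C)) (u : C) : C :=
  Cprod (map (fun p => qpoch_inf q (snd p * u) / qpoch_inf q (fst p * u)) l).

Lemma qbin_prod_sum (q : R) (l : list (C * C)) (u : C) :
  (0 < q < 1)%R -> (forall p, In p l -> (Cmod (fst p * u) < 1)%R) ->
  abs_summable (fun m => qbin_prod q l m * u ^ m) /\
  csum (fun m => qbin_prod q l m * u ^ m) (qratio q l u).
Proof.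
intros hq; induction l as [|[a b] l IH]; intros Hl.
- assert (H : forall n, qbin_prod q [] (S n) * u ^ (S n) = 0)
    by (intros; simpl; ring).
  assert (H0 := csum_single (fun m => qbin_prod q [] m * u ^ m) H).
  split; [|now replace (qratio q [] u) with (qbin_prod q [] 0 * u ^ 0)
             by (unfold qratio; simpl; ring)].
  apply ratio_test with (rho := fun _ => 0%R) (L := 0%R);
    [|apply is_lim_seq_const|lra].
  intros n; rewrite H, Cmod_0; lra.
- destruct IH as [IHa IHs]; [intros p Hp; apply Hl; now right|].
  assert (Ha : (Cmod (a * u) < 1)%R) by (apply (Hl (a, b)); now left).
  assert (He := qbin_abs_summable q a b u hq Ha).
  assert (Hs := qbinomial q a b u hq Ha).
  split.
  + apply abs_summable_ext with (2 := convolution_abs_summable _ _ IHa He).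
    intros n; apply convolution_pow.
  + destruct (convolution_csum (fun m => qbin_prod q l m * u ^ m)
      (fun m => qbin q a b m * u ^ m) (fun _ => 1)
      (fun _ => qpoch_inf q (b * u) / qpoch_inf q (a * u)) 1 IHa He) as [T [HT1 HT2]].
    * intros; rewrite Cmod_1; lra.
    * intros i; apply csum_ext with (2 := Hs); intros; ring.
    * assert (E : T = qratio q ((a, b) :: l) u).
      { apply csum_unique with (1 := HT1).
        change (qratio q ((a, b) :: l) u) with
          (qpoch_inf q (b * u) / qpoch_inf q (a * u) * qratio q l u).
        apply csum_ext with (2 := csum_scal _ _ _ IHs). intros; ring. }
      rewrite <- E. apply csum_ext with (2 := HT2).
      intros n; rewrite convolution_pow; apply Cmult_1_r.
Qed.

(** * Partial fractions *)

Lemma one_minus_qpow_lower (q : R) (x : C) :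
  (0 < q < 1)%R -> (forall m, 1 - x * RtoC (q ^ m) <> 0) ->
  exists delta : R, (0 < delta)%R /\
    forall m, (delta <= Cmod (1 - x * RtoC (q ^ m)))%R.
Proof.
intros hq Hx.
(* the factor 2 brings x q^N down to modulus less than 1/2 *)
destruct (qpow_small q (2 * x) hq) as [N HN].
assert (Htail : forall m, (N <= m)%nat -> (/ 2 <= Cmod (1 - x * RtoC (q ^ m)))%R).
{ intros m Hm. replace m with (N + (m - N))%nat by lia.
  rewrite RtoC_qpow_add, Cmult_assoc.
  assert (H := Cmod_qpow_le q (x * RtoC (q ^ N)) (m - N) hq).
  rewrite <- Cmult_assoc, Cmod_mult, Cmod_RtoC_pos in HN by lra.
  set (c := x * RtoC (q ^ N) * RtoC (q ^ (m - N))) in *.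
  assert (H1 := Cmod_triangle (1 - c) c).
  replace (1 - c + c) with (RtoC 1) in H1 by ring. rewrite Cmod_1 in H1. lra. }
assert (Hhead : forall M, exists delta : R, (0 < delta)%R /\
  forall m, (m < M)%nat -> (delta <= Cmod (1 - x * RtoC (q ^ m)))%R).
{ induction M as [|M (delta & H0 & H)]; [exists 1%R; split; [lra | lia]|].
  exists (Rmin delta (Cmod (1 - x * RtoC (q ^ M)))); split.
  - apply Rmin_pos; auto. now apply Cmod_gt_0.
  - intros m Hm. destruct (Nat.eq_dec m M) as [->|].
    + apply Rmin_r.
    + eapply Rle_trans; [apply Rmin_l | apply H; lia]. }
destruct (Hhead N) as (delta & H0 & H).
exists (Rmin delta (/ 2)); split; [apply Rmin_pos; lra|].
intros m; destruct (Nat.lt_ge_cases m N).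
- eapply Rle_trans; [apply Rmin_l | now apply H].
- eapply Rle_trans; [apply Rmin_r | now apply Htail].
Qed.

Lemma Cmod_inv_le (c : C) (delta : R) :
  (0 < delta)%R -> (delta <= Cmod c)%R -> (Cmod (/ c) <= / delta)%R.
Proof.
intros H0 H; rewrite Cmod_inv.
- now apply Rinv_le_contravar.
- apply Cmod_gt_0; lra.
Qed.

Lemma qbin_0_abs_summable (q : R) : (0 < q < 1)%R -> abs_summable (qbin q 0 (RtoC q)).
Proof.
intros hq.
apply abs_summable_ext with (fun m => qbin q 0 (RtoC q) m * 1 ^ m).
- intros m; rewrite Cpow_1_l; apply Cmult_1_r.
- apply qbin_abs_summable; auto. rewrite Cmult_0_l, Cmod_0; lra.
Qed.

(** With G the sum below, (1 - x) G(x) = G(q x): the defect is Euler's series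
    at 1/q, that is (1; q)_inf = 0. Iterating brings x to 0. *)
Lemma inv_qpoch_partial_fractions (q : R) (x : C) :
  (0 < q < 1)%R -> (forall m, 1 - x * RtoC (q ^ m) <> 0) ->
  csum (fun m => qbin q 0 (RtoC q) m * / (1 - x * RtoC (q ^ m)))
    (qpoch_inf q (RtoC q) / qpoch_inf q x).
Proof.
intros hq Hx; assert (Hq := RtoC_q_neq0 q hq).
destruct (one_minus_qpow_lower q x hq Hx) as (delta & H0 & Hdelta).
assert (HA : ex_series (fun m => Cmod (qbin q 0 (RtoC q) m) * / delta)%R)
  by exact (ex_series_scal_r (/ delta)%R _ (qbin_0_abs_summable q hq)).
assert (Hbound : forall n m,
  (Cmod (qbin q 0 (RtoC q) m * / (1 - x * RtoC (q ^ n) * RtoC (q ^ m)))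
   <= Cmod (qbin q 0 (RtoC q) m) * / delta)%R).
{ intros n m; rewrite Cmod_mult. apply Rmult_le_compat_l; [apply Cmod_ge_0|].
  rewrite <- Cmult_assoc, <- RtoC_qpow_add. now apply Cmod_inv_le. }
destruct (ClassicalEpsilon.choice (fun (n : nat) (g : C) =>
  csum (fun m => qbin q 0 (RtoC q) m * / (1 - x * RtoC (q ^ n) * RtoC (q ^ m))) g))
  as [G HG].
{ intros n; apply abs_summable_csum, abs_summable_le with (2 := HA); auto. }
assert (Hone : qpoch_inf q 1 = 0) by (rewrite qpoch_inf_succ by exact hq; ring).
assert (Hstep : forall n, G (S n) = (1 - x * RtoC (q ^ n)) * G n).
{ intros n.
  assert (Hterm : forall k,
    qbin q 0 (RtoC q) (S k) * (/ RtoC q) ^ S k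
    + qbin q 0 (RtoC q) k * / (1 - x * RtoC (q ^ S n) * RtoC (q ^ k)) =
    (1 - x * RtoC (q ^ n))
    * (qbin q 0 (RtoC q) (S k) * / (1 - x * RtoC (q ^ n) * RtoC (q ^ S k)))).
  { intros k.
    assert (Hk := one_minus_qpow_S_neq0 q k hq).
    assert (Hxk := Hx (n + S k)%nat).
    rewrite RtoC_qpow_add, RtoC_qpow_S in Hxk.
    change (qbin q 0 (RtoC q) (S k)) with
      (qbin q 0 (RtoC q) k * (0 - RtoC q * RtoC (q ^ k)) / (1 - RtoC (q ^ S k))).
    assert (Hqk : RtoC (q ^ k) <> 0) by (apply RtoC_neq0, pow_nonzero; lra).
    assert (Hpow : (/ RtoC q) ^ S k = / (RtoC q * RtoC (q ^ k))).
    { rewrite RtoC_pow. simpl. rewrite Cpow_inv by exact Hq. field.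
      split; auto. now apply Cpow_nz. }
    rewrite Hpow, !RtoC_qpow_S in *.
    field. repeat split; auto; intros F; apply Hxk; rewrite <- F; ring. }
  assert (HE := euler_qbinomial q (/ RtoC q) hq).
  rewrite Cinv_r, Hone in HE by exact Hq.
  assert (HE' := csum_incr_1 _ _ HE).
  assert (HG' := csum_incr_1 _ _ (csum_scal (1 - x * RtoC (q ^ n)) _ _ (HG n))).
  assert (E := csum_unique _ _ _ HG'
    (csum_ext _ _ _ Hterm (csum_plus _ _ _ _ HE' (HG (S n))))).
  assert (Hn := Hx n). simpl in E. rewrite !Cmult_1_r in E.
  transitivity (0 - 1 + G (S n) + 1); [ring|].
  rewrite <- E. field. exact Hn. }
assert (HG0 : csum (fun m => qbin q 0 (RtoC q) m * / (1 - x * RtoC (q ^ m))) (G O)).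
{ apply csum_ext with (2 := HG O); intros m; simpl. now rewrite Cmult_1_r. }
replace (qpoch_inf q (RtoC q) / qpoch_inf q x) with (G O); [exact HG0|].
assert (HGn : forall n, G n = qpoch q x n * G O).
{ induction n as [|n IH]; [simpl; ring|].
  rewrite Hstep, IH, qpoch_succ_r; ring. }
destruct (tannery
  (fun n m => qbin q 0 (RtoC q) m * / (1 - x * RtoC (q ^ n) * RtoC (q ^ m)))
  (qbin q 0 (RtoC q)) G (fun m => Cmod (qbin q 0 (RtoC q) m) * / delta)%R)
  as [S [HS HGS]]; auto.
{ intros m. rewrite <- (Cmult_1_r (qbin q 0 (RtoC q) m)) at 1.
  apply tends_scal.
  apply tends_le0 with (fun n => / delta * (Cmod x * q ^ n))%R.
  - intros n. rewrite <- Cmult_assoc, <- RtoC_qpow_add.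
    assert (Hnm := Hx (n + m)%nat).
    replace (/ (1 - x * RtoC (q ^ (n + m))) - 1)
      with (/ (1 - x * RtoC (q ^ (n + m))) * (x * RtoC (q ^ (n + m))))
      by (field; exact Hnm).
    rewrite Cmod_mult. apply Rmult_le_compat; try apply Cmod_ge_0.
    + now apply Cmod_inv_le.
    + rewrite RtoC_qpow_add, Cmult_assoc.
      eapply Rle_trans; [now apply Cmod_qpow_le|].
      rewrite Cmod_mult, Cmod_RtoC_pos; [lra | apply pow_le; lra].
  - replace (Finite 0) with (Finite (/ delta * (Cmod x * 0))) by (f_equal; ring).
    repeat apply is_lim_seq_mult'; auto using is_lim_seq_const, qpow_lim. }
assert (ES : S = qpoch_inf q (RtoC q)).
{ apply csum_unique with (1 := HS).
  rewrite <- (Cmult_1_r (RtoC q)) at 2.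
  apply csum_ext with (2 := euler_qbinomial q 1 hq).
  intros m; rewrite Cpow_1_l; apply Cmult_1_r. }
assert (E : qpoch_inf q (RtoC q) = qpoch_inf q x * G O).
{ rewrite <- ES. apply tends_unique with (1 := HGS).
  apply tends_ext with (fun n => qpoch q x n * G O); [intros; symmetry; apply HGn|].
  apply tends_mult; [now apply qpoch_inf_tends | apply tends_const]. }
rewrite E. field. now apply qpoch_inf_neq0.
Qed.

(** * The identity theorem on the slit plane *)

Lemma is_pseries_csum (c : nat -> C) (h l : C) :
  is_pseries (K := C_AbsRing) (V := C_NormedModule) c h l <->
  csum (fun j => h ^ j * c j) l.
Proof.
assert (E : forall j, pow_n (K := C_Ring) h j = h ^ j).
{ induction j as [|j IH]; [easy|]. simpl. now rewrite <- IH. }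
split; apply csum_ext; intros j; [|symmetry];
  exact (f_equal (fun t => t * c j) (E j)).
Qed.

Lemma csum_terms_bounded (u : nat -> C) (l : C) :
  csum u l -> exists B : R, forall n, (Cmod (u n) <= B)%R.
Proof.
intros H.
destruct (filterlim_bounded (V := C_NormedModule) (sum_n u)) as [M HM]; [now exists l|].
change (forall n, (Cmod (sum_n u n) <= M)%R) in HM.
exists (M + M)%R; intros [|n].
- specialize (HM O); rewrite sum_O in HM. pose proof (Cmod_ge_0 (u O)). lra.
- replace (u (S n)) with (sum_n u (S n) + - sum_n u n) by (rewrite sum_n_C; ring).
  eapply Rle_trans; [apply Cmod_triangle|]. rewrite Cmod_opp.
  apply Rplus_le_compat; apply HM.
Qed.

Lemma csum_drop_zeros (u : nat -> C) (l : C) (j : nat) :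
  csum u l -> (forall i, (i < j)%nat -> u i = 0) -> csum (fun i => u (j + i)%nat) l.
Proof.
intros Hu; induction j as [|j IH]; intros Hj; [exact Hu|].
replace l with (l - u (j + 0)%nat) by (rewrite Nat.add_0_r, Hj by lia; ring).
apply csum_ext with (fun i => u (j + S i)%nat).
- intros i; f_equal; lia.
- apply (csum_incr_1 (fun i => u (j + i)%nat)), IH. intros i Hi; apply Hj; lia.
Qed.

(** The lowest nonzero coefficient would dominate the rest of the series close
    to the center. *)
Lemma pseries_vanishing_on_ray (c : nat -> C) (v : C) (delta : R) :
  (0 < delta)%R -> v <> 0 ->
  (forall t : R, (0 < t < delta)%R -> csum (fun j => (RtoC t * v) ^ j * c j) (RtoC 0)) ->
  forall j, c j = 0.
Proof.
intros Hdelta Hv H j.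
induction j as [j IH] using lt_wf_ind.
assert (Htail : forall t : R, (0 < t < delta)%R ->
  csum (fun i => (RtoC t * v) ^ i * c (j + i)%nat) (RtoC 0)).
{ intros t Ht.
  assert (Hh : RtoC t * v <> 0) by (apply Cmult_neq_0; auto; apply RtoC_neq0; lra).
  assert (Hhj := Cpow_nz _ j Hh).
  replace (RtoC 0) with (/ (RtoC t * v) ^ j * 0) by ring.
  apply csum_ext with (fun i => / (RtoC t * v) ^ j * ((RtoC t * v) ^ (j + i) * c (j + i)%nat)).
  - intros i; rewrite Cpow_add_r. field; auto.
  - apply csum_scal, (csum_drop_zeros _ _ j (H t Ht)).
    intros i Hi; rewrite IH by exact Hi; ring. }
set (t0 := (delta / 2)%R).
destruct (csum_terms_bounded _ _ (Htail t0 ltac:(unfold t0; lra))) as [B HB].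
assert (HB0 : (0 <= B)%R) by (eapply Rle_trans; [apply Cmod_ge_0 | apply (HB O)]).
assert (Hsmall : forall s : R, (0 < s < / 2)%R -> (Cmod (c j) <= 2 * B * s)%R).
{ intros s Hs.
  assert (Ht := Htail (s * t0)%R ltac:(unfold t0; nra)).
  assert (Hi := csum_incr_1 _ _ Ht). simpl in Hi.
  rewrite Nat.add_0_r in Hi.
  assert (Hgeom : ex_series (fun i => B * s * s ^ i)%R).
  { apply (ex_series_scal (V := R_NormedModule) (B * s)%R (fun i => s ^ i)%R).
    apply ex_series_geom. rewrite Rabs_pos_eq; lra. }
  assert (Hle : forall i, (Cmod (RtoC (s * t0) * v * (RtoC (s * t0) * v) ^ i
                                 * c (j + S i)%nat) <= B * s * s ^ i)%R).
  { intros i.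
    change (RtoC (s * t0) * v * (RtoC (s * t0) * v) ^ i) with ((RtoC (s * t0) * v) ^ S i).
    replace (RtoC (s * t0) * v) with (RtoC s * (RtoC t0 * v))
      by (rewrite RtoC_mult; ring).
    rewrite Cpow_mult_l, <- Cmult_assoc, Cmod_mult, Cmod_pow, Cmod_RtoC_pos by lra.
    simpl pow. assert (0 <= s * s ^ i)%R by (apply Rmult_le_pos; [|apply pow_le]; lra).
    specialize (HB (S i)). nra. }
  apply csum_norm_le in Hi; [|now apply abs_summable_le with (2 := Hgeom)].
  replace (0 - 1 * c j) with (- c j) in Hi by ring. rewrite Cmod_opp in Hi.
  eapply Rle_trans; [exact Hi|].
  apply Rle_trans with (Series (fun i => B * s * s ^ i)%R).
  - apply Series_le; auto. intros i; split; [apply Cmod_ge_0 | apply Hle].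
  - rewrite Series_scal_l, Series_geom by (rewrite Rabs_pos_eq; lra).
    assert (/ (1 - s) <= 2)%R.
    { rewrite <- (Rinv_inv 2). apply Rinv_le_contravar; lra. }
    assert (0 <= B * s)%R by (apply Rmult_le_pos; lra). nra. }
apply Cmod_eq_0. apply Rle_antisym; [|apply Cmod_ge_0].
apply Rnot_lt_le; intros Hc.
set (s := Rmin (/ 4) (Cmod (c j) / (4 * (B + 1)))).
assert (Hq : (0 < Cmod (c j) / (4 * (B + 1)))%R) by (apply Rdiv_lt_0_compat; lra).
assert (Hs : (0 < s < / 2)%R).
{ unfold s; split; [apply Rmin_pos; lra|].
  eapply Rle_lt_trans; [apply Rmin_l|]; lra. }
assert (Hs2 : (s * (4 * (B + 1)) <= Cmod (c j))%R).
{ apply Rle_trans with (Cmod (c j) / (4 * (B + 1)) * (4 * (B + 1)))%R.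
  - apply Rmult_le_compat_r; [lra | apply Rmin_r].
  - right; field; lra. }
specialize (Hsmall s Hs). nra.
Qed.

Lemma slit_plane_star (w : C) (s : R) :
  ~ in_real_ge 1 w -> (0 <= s <= 1)%R -> ~ in_real_ge 1 (RtoC s * w).
Proof.
unfold in_real_ge; destruct w as [wr wi]; unfold Re, Im; simpl.
intros Hw Hs [Hi Hr]. apply Hw.
assert (Hs0 : (s <> 0)%R) by (intros ->; lra).
assert (Hwi : wi = 0%R).
{ apply Rmult_eq_reg_l with s; auto. lra. }
split; auto. subst wi. destruct (Rlt_le_dec wr 1); auto. exfalso; nra.
Qed.

(** The slit plane is star-shaped about 0. Along a ray from 0, the equality
    cannot stop at an interior point: there the two local expansions agree on
    one side, hence everywhere. *)
Lemma identity_theorem (F G : C -> C) :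
  analytic_on (fun w => ~ in_real_ge 1 w) F ->
  analytic_on (fun w => ~ in_real_ge 1 w) G ->
  (forall w, (Cmod w < 1)%R -> F w = G w) ->
  forall w, ~ in_real_ge 1 w -> F w = G w.
Proof.
intros HF HG Hdisk w Hw.
destruct (Ceq_dec w 0) as [->|Hw0]; [apply Hdisk; rewrite Cmod_0; lra|].
assert (Hwpos : (0 < Cmod w)%R) by now apply Cmod_gt_0.
set (E := fun s : R => (0 <= s <= 1)%R /\
  forall s' : R, (0 <= s' <= s)%R -> F (RtoC s' * w) = G (RtoC s' * w)).
destruct (completeness E) as [T [HTub HTlub]].
{ exists 1%R; intros s [Hs _]; lra. }
{ exists 0%R; split; [lra|]. intros s' Hs'. replace s' with 0%R by lra.
  apply Hdisk. rewrite Cmult_0_l, Cmod_0; lra. }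
assert (HT1 : (T <= 1)%R) by (apply HTlub; intros s [Hs _]; lra).
assert (HT0 : (0 < T)%R).
{ set (s := Rmin 1 (/ (2 * Cmod w))).
  assert (H2 : (0 < / (2 * Cmod w))%R) by (apply Rinv_0_lt_compat; lra).
  apply Rlt_le_trans with s; [apply Rmin_pos; lra|].
  apply HTub; split; [split; [left; apply Rmin_pos; lra | apply Rmin_l]|].
  intros s' Hs'. apply Hdisk. rewrite Cmod_mult, Cmod_RtoC_pos by lra.
  apply Rle_lt_trans with (/ (2 * Cmod w) * Cmod w)%R.
  - apply Rmult_le_compat_r; [lra|].
    eapply Rle_trans; [apply Hs' | apply Rmin_r].
  - replace (/ (2 * Cmod w) * Cmod w)%R with (/ 2)%R by (field; lra). lra. }
assert (Hbelow : forall s : R, (0 <= s < T)%R -> F (RtoC s * w) = G (RtoC s * w)).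
{ intros s Hs. destruct (Classical_Prop.classic (exists s1, E s1 /\ (s < s1)%R))
    as [(s1 & [_ H1] & Hss1)|Hno]; [apply H1; lra|].
  exfalso. assert (T <= s)%R; [|lra]. apply HTlub; intros s1 Hs1.
  apply Rnot_lt_le; intros Hlt; apply Hno; now exists s1. }
assert (HTD := slit_plane_star w T Hw ltac:(lra)).
destruct (HF _ HTD) as (c & r & Hc). destruct (HG _ HTD) as (d & r' & Hd).
set (rho := (Rmin r r' / Cmod w)%R).
assert (Hrho : (0 < rho)%R).
{ apply Rdiv_lt_0_compat; auto. apply Rmin_pos; apply cond_pos. }
assert (Hrad : forall t : R, (Rabs t < rho)%R ->
  (Cmod (RtoC t * w) < r)%R /\ (Cmod (RtoC t * w) < r')%R).
{ intros t Ht. rewrite Cmod_mult, Cmod_R.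
  assert (H : (Rabs t * Cmod w < Rmin r r')%R).
  { apply Rlt_le_trans with (rho * Cmod w)%R.
    - now apply Rmult_lt_compat_r.
    - right; unfold rho; field; lra. }
  split; eapply Rlt_le_trans; eauto using Rmin_l, Rmin_r. }
assert (Hcd : forall j, c j - d j = 0).
{ apply (pseries_vanishing_on_ray (fun j => c j - d j) (- w) (Rmin T rho)).
  - now apply Rmin_pos.
  - now apply Copp_neq0.
  - intros t Ht.
    assert (HtT : (t < T)%R) by (eapply Rlt_le_trans; [apply Ht | apply Rmin_l]).
    assert (Htr : (t < rho)%R) by (eapply Rlt_le_trans; [apply Ht | apply Rmin_r]).
    destruct (Hrad (- t)%R) as [H1 H2];
      [rewrite Rabs_Ropp, Rabs_pos_eq; lra|].
    specialize (Hc _ H1); specialize (Hd _ H2).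
    rewrite is_pseries_csum in Hc, Hd.
    replace (RtoC T * w + RtoC (- t) * w) with (RtoC (T - t) * w) in Hc, Hd
      by (rewrite RtoC_minus, RtoC_opp; ring).
    rewrite (Hbelow (T - t)%R) in Hc by lra.
    replace (RtoC 0) with (G (RtoC (T - t) * w) - G (RtoC (T - t) * w)) by ring.
    apply csum_ext with (2 := csum_minus _ _ _ _ Hc Hd).
    intros j. replace (RtoC t * - w) with (RtoC (- t) * w) by (rewrite RtoC_opp; ring).
    ring. }
assert (Hnear : forall t : R, (Rabs t < rho)%R ->
  F (RtoC (T + t) * w) = G (RtoC (T + t) * w)).
{ intros t Ht. destruct (Hrad t Ht) as [H1 H2].
  specialize (Hc _ H1); specialize (Hd _ H2). rewrite is_pseries_csum in Hc, Hd.
  replace (RtoC (T + t) * w) with (RtoC T * w + RtoC t * w)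
    by (rewrite RtoC_plus; ring).
  apply csum_unique with (1 := Hc). apply csum_ext with (2 := Hd).
  intros j. replace (c j) with (d j + (c j - d j)) by ring. rewrite Hcd; ring. }
assert (HTeq : T = 1%R).
{ apply Rle_antisym; auto. apply Rnot_lt_le; intros HTlt.
  set (s := Rmin 1 (T + rho / 2)).
  assert (Hs : E s).
  { split.
    - split; [left; apply Rmin_pos; lra | apply Rmin_l].
    - intros s' Hs'. destruct (Rlt_le_dec s' T) as [Hlt|Hge]; [apply Hbelow; lra|].
      assert (s' <= T + rho / 2)%R
        by (eapply Rle_trans; [apply Hs' | apply Rmin_r]).
      replace s' with (T + (s' - T))%R by ring.
      apply Hnear. rewrite Rabs_pos_eq; lra. }
  apply HTub in Hs. unfold s in Hs.
  assert (T < Rmin 1 (T + rho / 2))%R by (apply Rmin_glb_lt; lra). lra. }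
specialize (Hnear 0%R). rewrite Rabs_R0, HTeq, Rplus_0_r, Cmult_1_l in Hnear.
now apply Hnear.
Qed.

(** * Analytic continuation by partial fractions *)

(** A total operation, so that the continuation below is also defined, with
    meaningless values, at its poles. *)
Definition total (u : nat -> C) : C :=
  iota (T := C_CompleteNormedModule) (fun l : C => csum u l).

Lemma csum_total (u : nat -> C) (l : C) : csum u l -> total u = l.
Proof.
intros Hl.
exact (iota_filterlim_locally (V := C_CompleteNormedModule) (sum_n u) l Hl).
Qed.

Lemma total_correct (u : nat -> C) : abs_summable u -> csum u (total u).
Proof.
intros Hu; destruct (abs_summable_csum u Hu) as [l Hl].
now rewrite (csum_total u l Hl).
Qed.

Lemma csum_geom (rho : C) : (Cmod rho < 1)%R -> csum (fun n => rho ^ n) (/ (1 - rho)).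
Proof.
intros H.
destruct (abs_summable_csum (fun n => rho ^ n)) as [l Hl].
{ apply abs_summable_le with (fun n => Cmod rho ^ n)%R.
  - intros n; rewrite Cmod_pow; apply Rle_refl.
  - apply ex_series_geom. rewrite Rabs_pos_eq; auto using Cmod_ge_0. }
assert (E := csum_unique _ _ _ (csum_incr_1 _ _ Hl) (csum_scal rho _ _ Hl)).
simpl in E. assert (H1 := one_minus_neq0 rho H).
replace (/ (1 - rho)) with l; [exact Hl|].
transitivity ((l - rho * l) / (1 - rho)); [field; auto|].
rewrite <- E. field; auto.
Qed.

Definition pole_series (q : R) (d : nat -> C) (x : C) : nat -> C :=
  fun m => d m * / (1 - x * RtoC (q ^ m)).

(** The geometric expansion of 1 / (1 - (w + h) s) has the coefficients
    s^j / (1 - w s)^(j+1); here s runs through the powers of q. *)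
Definition pole_taylor (q : R) (d : nat -> C) (w : C) (j : nat) : C :=
  total (fun m => d m * RtoC (q ^ m) ^ j * (/ (1 - w * RtoC (q ^ m))) ^ S j).

Lemma pole_series_abs_summable (q : R) (d : nat -> C) (x : C) :
  (0 < q < 1)%R -> abs_summable d -> (forall m, 1 - x * RtoC (q ^ m) <> 0) ->
  abs_summable (pole_series q d x).
Proof.
intros hq Hd Hx.
destruct (one_minus_qpow_lower q x hq Hx) as (delta & H0 & Hdelta).
apply abs_summable_le with (fun m => Cmod (d m) * / delta)%R.
- intros m; unfold pole_series; rewrite Cmod_mult.
  apply Rmult_le_compat_l; [apply Cmod_ge_0 | now apply Cmod_inv_le].
- exact (ex_series_scal_r (/ delta)%R _ Hd).
Qed.

(** [h] is shorter, by a uniform factor, than the distance from [w] to any pole,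
    so the geometric expansions about [w] of all the fractions can be added up. *)
Lemma pole_series_taylor (q : R) (d : nat -> C) (w h : C) (eta : R) :
  (0 < q < 1)%R -> abs_summable d ->
  (forall m, 1 - w * RtoC (q ^ m) <> 0) -> (0 <= eta < 1)%R ->
  (forall m, (Cmod h <= eta * Cmod (1 - w * RtoC (q ^ m)))%R) ->
  csum (fun j => h ^ j * pole_taylor q d w j) (total (pole_series q d (w + h))).
Proof.
intros hq Hd Hw Heta Hh.
destruct (one_minus_qpow_lower q w hq Hw) as (delta & H0 & Hdelta).
set (p := fun m => 1 - w * RtoC (q ^ m)).
set (rho := fun m => h * RtoC (q ^ m) * / p m).
assert (Hrho : forall m, (Cmod (rho m) <= eta)%R).
{ intros m; unfold rho; rewrite Cmod_mult, Cmod_inv by apply Hw.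
  assert (Hp : (0 < Cmod (p m))%R) by apply Cmod_gt_0, Hw.
  apply Rmult_le_reg_r with (Cmod (p m)); auto.
  rewrite Rmult_assoc, Rinv_l, Rmult_1_r by lra.
  eapply Rle_trans; [now apply Cmod_qpow_le | apply Hh]. }
assert (Hwh : forall m, 1 - (w + h) * RtoC (q ^ m) = p m * (1 - rho m)).
{ intros m; unfold rho. assert (Hp : p m <> 0) by apply Hw.
  transitivity (p m - h * RtoC (q ^ m)); [unfold p; ring | field; exact Hp]. }
assert (Hrho1 : forall m, 1 - rho m <> 0).
{ intros m; apply one_minus_neq0. eapply Rle_lt_trans; [apply Hrho | lra]. }
assert (Hinv : forall m, (Cmod (/ p m) <= / delta)%R)
  by (intros m; apply Cmod_inv_le; [exact H0 | apply Hdelta]).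
set (u := fun m j => d m * / p m * rho m ^ j).
set (A := fun m => (Cmod (d m) * (/ delta * / (1 - eta)))%R).
assert (HA : ex_series A) by exact (ex_series_scal_r _ _ Hd).
refine (series_swap u A (pole_series q d (w + h)) _ _ _ HA _ _ _).
- intros m n. rewrite (sum_n_Cmod_scal (d m * / p m) (fun j => rho m ^ j)).
  unfold A; rewrite Cmod_mult, Rmult_assoc.
  apply Rmult_le_compat_l; [apply Cmod_ge_0|].
  apply Rmult_le_compat; auto using Cmod_ge_0.
  + eapply Rle_trans; [apply Cmod_ge_0 | apply (Cmod_sum_n_le (fun j => rho m ^ j))].
  + apply Rle_trans with (sum_n (fun j => eta ^ j)%R n).
    * apply sum_n_m_le; intros j. rewrite Cmod_pow. apply pow_incr.
      split; [apply Cmod_ge_0 | apply Hrho].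
    * rewrite <- Series_geom by (rewrite Rabs_pos_eq; lra).
      apply sum_n_le_Series; [intros; apply pow_le; lra|].
      apply ex_series_geom; rewrite Rabs_pos_eq; lra.
- intros m. unfold pole_series; rewrite Hwh.
  replace (d m * / (p m * (1 - rho m))) with (d m * / p m * / (1 - rho m)).
  + apply csum_scal, csum_geom. eapply Rle_lt_trans; [apply Hrho | lra].
  + assert (Hp : p m <> 0) by apply Hw. specialize (Hrho1 m). field. auto.
- intros j. unfold pole_taylor.
  apply csum_ext with
    (fun m => h ^ j * (d m * RtoC (q ^ m) ^ j * (/ p m) ^ S j)).
  + intros m; unfold u, rho. rewrite !Cpow_mult_l. simpl; ring.
  + apply csum_scal, total_correct.
    apply abs_summable_le with (fun m => Cmod (d m) * (/ delta) ^ S j)%R;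
      [|exact (ex_series_scal_r _ _ Hd)].
    intros m. rewrite !Cmod_mult, !Cmod_pow, Cmod_RtoC_pos by (apply pow_le; lra).
    apply Rmult_le_compat.
    * apply Rmult_le_pos; [apply Cmod_ge_0 | apply pow_le, pow_le; lra].
    * apply pow_le, Cmod_ge_0.
    * rewrite <- (Rmult_1_r (Cmod (d m))) at 2.
      apply Rmult_le_compat_l; [apply Cmod_ge_0|].
      rewrite <- (pow1 j). apply pow_incr.
      destruct (qpow_bounds q m hq); lra.
    * apply pow_incr; split; [apply Cmod_ge_0 | apply Hinv].
- apply total_correct, pole_series_abs_summable; auto.
  intros m; rewrite Hwh. apply Cmult_neq_0; [apply Hw | apply Hrho1].
Qed.

(** The poles q^(-m) lie on the slit. *)
Lemma slit_plane_no_pole (q : R) (w : C) (m : nat) :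
  (0 < q < 1)%R -> ~ in_real_ge 1 w -> 1 - w * RtoC (q ^ m) <> 0.
Proof.
intros hq Hw E; apply Hw. destruct (qpow_bounds q m hq) as [H0 H1].
assert (Hqm : RtoC (q ^ m) <> 0) by (apply RtoC_neq0; lra).
replace w with (RtoC (/ q ^ m)).
- split; simpl; [easy|]. rewrite <- Rinv_1. apply Rinv_le_contravar; lra.
- rewrite RtoC_inv by lra.
  transitivity ((1 - w * RtoC (q ^ m)) * / RtoC (q ^ m) + w).
  + field; exact Hqm.
  + rewrite E; ring.
Qed.

(** The poles stay away from [w] because they only accumulate at infinity. *)
Lemma pole_series_analytic (q : R) (d : nat -> C) (K : C) :
  (0 < q < 1)%R -> abs_summable d ->
  analytic_on (fun w => ~ in_real_ge 1 w) (fun x => K * total (pole_series q d x)).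
Proof.
intros hq Hd w Hw.
assert (Hpole := fun m => slit_plane_no_pole q w m hq Hw).
destruct (one_minus_qpow_lower q w hq Hpole) as (delta & H0 & Hdelta).
assert (Hr : (0 < delta / 2)%R) by lra.
exists (fun j => K * pole_taylor q d w j), (mkposreal _ Hr); intros h Hh.
simpl in Hh. apply is_pseries_csum.
assert (H := pole_series_taylor q d w h (/ 2) hq Hd Hpole).
apply csum_ext with (fun j => K * (h ^ j * pole_taylor q d w j)); [intros; ring|].
apply csum_scal, H; [lra|].
intros m; specialize (Hdelta m); lra.
Qed.

(** * The basic hypergeometric function *)

Lemma Cprod_app (s t : list C) : Cprod (s ++ t) = Cprod s * Cprod t.
Proof. induction s as [|y s IH]; simpl; [|rewrite IH]; ring. Qed.

Lemma qpochs_inf_app (q : R) (s t : list C) :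
  qpochs_inf q (s ++ t) = qpochs_inf q s * qpochs_inf q t.
Proof. unfold qpochs_inf; now rewrite map_app, Cprod_app. Qed.

Lemma Cprod_map_neq0 (f : C -> C) (s : list C) :
  (forall y, In y s -> f y <> 0) -> Cprod (map f s) <> 0.
Proof.
induction s as [|y s IH]; intros H; simpl; [apply C1_nz|].
apply Cmult_neq_0; [apply H; now left | apply IH; intros; apply H; now right].
Qed.

Definition qpochs_inf_scaled (q : R) (s : list C) (u : C) : C :=
  Cprod (map (fun y => qpoch_inf q (y * u)) s).

Lemma qpochs_inf_split (q : R) (s : list C) (j : nat) :
  (0 < q < 1)%R ->
  qpochs_inf q s = qpochs q s j * qpochs_inf_scaled q s (RtoC (q ^ j)).
Proof.
intros hq; unfold qpochs_inf, qpochs, qpochs_inf_scaled.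
induction s as [|y s IH]; simpl; [ring|].
rewrite IH, (qpoch_inf_split q y j hq); ring.
Qed.

(** The parameter lists of a (k+1)phi_k series have different lengths; the
    upper parameter left over is paired with 0. *)
Definition parameter_pairs (a b : list C) : list (C * C) :=
  combine a (b ++ [RtoC 0]).

Lemma qratio_combine (q : R) (a b : list C) (u : C) :
  length a = length b -> (forall y, In y a -> qpoch_inf q (y * u) <> 0) ->
  qratio q (combine a b) u = qpochs_inf_scaled q b u / qpochs_inf_scaled q a u.
Proof.
unfold qratio, qpochs_inf_scaled.
revert b; induction a as [|y a IH]; intros [|y' b] Hlen Ha; try easy.
- simpl; field.
- simpl. rewrite IH; [| now injection Hlen | intros; apply Ha; now right].
  assert (Hy := Ha y (or_introl eq_refl)).
  assert (H : Cprod (map (fun y => qpoch_inf q (y * u)) a) <> 0)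
    by (apply Cprod_map_neq0; intros; apply Ha; now right).
  field. auto.
Qed.

Lemma qratio_parameter_pairs (q : R) (a b : list C) (u : C) :
  (0 < q < 1)%R -> length a = S (length b) ->
  (forall y, In y a -> (Cmod (y * u) < 1)%R) ->
  qratio q (parameter_pairs a b) u =
  qpochs_inf_scaled q b u / qpochs_inf_scaled q a u.
Proof.
intros hq Hlen Ha; unfold parameter_pairs.
rewrite qratio_combine.
- f_equal. unfold qpochs_inf_scaled. rewrite map_app, Cprod_app; simpl.
  rewrite Cmult_0_l, qpoch_inf_0 by exact hq. ring.
- rewrite length_app; simpl; lia.
- intros y Hy. now apply qpoch_inf_disk_neq0; auto.
Qed.

(** The pair (0, q) contributes the factor (q u; q)_inf, which at u = q^j gives
    the denominator (q; q)_j. *)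
Definition pole_coef (q : R) (a b : list C) : nat -> C :=
  qbin_prod q ((RtoC 0, RtoC q) :: parameter_pairs a b).

(** The limit of the coefficients (a; q)_j / (q, b; q)_j as j tends to
    infinity. *)
Definition hyp_constant (q : R) (a b : list C) : C :=
  qpochs_inf q a / (qpochs_inf q b * qpoch_inf q (RtoC q)).

Lemma lower_parameter_no_zero (q : R) (y : C) :
  (0 < q < 1)%R ->
  (forall n : nat, y <> RtoC (powerRZ q (- Z.of_nat n))) ->
  forall n, 1 - y * RtoC (q ^ n) <> 0.
Proof.
intros hq Hy n E; apply (Hy n).
assert (Hq := RtoC_q_neq0 q hq).
assert (Hqn : RtoC (q ^ n) <> 0) by (apply RtoC_neq0, pow_nonzero; lra).
rewrite Cpowz_RtoC, Cpowz_opp, Cpowz_qpow by (auto; lra).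
transitivity (y + (1 - y * RtoC (q ^ n)) * / RtoC (q ^ n)).
- rewrite E; ring.
- field; exact Hqn.
Qed.

Lemma parameter_pairs_bound (q : R) (a b : list C) (u : C) :
  (forall y, In y a -> (Cmod (y * u) < 1)%R) ->
  forall p, In p (parameter_pairs a b) -> (Cmod (fst p * u) < 1)%R.
Proof. intros H [y y'] Hp; apply H. now apply in_combine_l in Hp. Qed.

Lemma pole_coef_sum (q : R) (a b : list C) (u : C) :
  (0 < q < 1)%R -> length a = S (length b) ->
  (forall y, In y a -> (Cmod (y * u) < 1)%R) ->
  abs_summable (fun m => pole_coef q a b m * u ^ m) /\
  csum (fun m => pole_coef q a b m * u ^ m)
    (qpoch_inf q (RtoC q * u)
     * (qpochs_inf_scaled q b u / qpochs_inf_scaled q a u)).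
Proof.
intros hq Hlen Ha.
replace (qpoch_inf q (RtoC q * u)
     * (qpochs_inf_scaled q b u / qpochs_inf_scaled q a u))
  with (qratio q ((RtoC 0, RtoC q) :: parameter_pairs a b) u).
- apply qbin_prod_sum; auto. intros p [<- | Hp].
  + simpl; rewrite Cmult_0_l, Cmod_0; lra.
  + now apply (parameter_pairs_bound q a b u Ha).
- rewrite <- (qratio_parameter_pairs q a b u) by auto.
  unfold qratio; simpl. rewrite Cmult_0_l, qpoch_inf_0 by exact hq. field.
Qed.

Lemma Cmod_lt1_qpow (q : R) (a : list C) (j : nat) :
  (0 < q < 1)%R -> (forall y, In y a -> (Cmod y < 1)%R) ->
  forall y, In y a -> (Cmod (y * RtoC (q ^ j)) < 1)%R.
Proof.
intros hq Ha y Hy. eapply Rle_lt_trans; [now apply Cmod_qpow_le | now apply Ha].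
Qed.

Lemma pole_coef_abs_summable (q : R) (a b : list C) :
  (0 < q < 1)%R -> length a = S (length b) ->
  (forall y, In y a -> (Cmod y < 1)%R) -> abs_summable (pole_coef q a b).
Proof.
intros hq Hlen Ha.
assert (H1 := Cmod_lt1_qpow q a 0 hq Ha).
apply abs_summable_ext with (2 := proj1 (pole_coef_sum q a b _ hq Hlen H1)).
intros m; simpl; rewrite Cpow_1_l; apply Cmult_1_r.
Qed.

(** The sequence j |-> (a; q)_j / (q, b; q)_j is a constant times the value at
    q^j of (q u, b u; q)_inf / (a u; q)_inf. *)
Lemma hyp_coef_pole_taylor (q : R) (a b : list C) (j : nat) :
  (0 < q < 1)%R -> length a = S (length b) ->
  (forall y, In y a -> (Cmod y < 1)%R) ->
  (forall y, In y b -> forall n, 1 - y * RtoC (q ^ n) <> 0) ->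
  hyp_constant q a b * pole_taylor q (pole_coef q a b) 0 j = hyp_coef q a b j.
Proof.
intros hq Hlen Ha Hb.
assert (Haj := Cmod_lt1_qpow q a j hq Ha).
destruct (pole_coef_sum q a b _ hq Hlen Haj) as [_ Hs].
unfold pole_taylor.
erewrite csum_total.
2:{ apply csum_ext with (2 := Hs). intros m.
    rewrite !RtoC_pow, <- !Cpow_mult_r, (Nat.mul_comm j m), Cmult_0_l.
    replace (/ (1 - 0)) with (RtoC 1) by field.
    rewrite Cpow_1_l; ring. }
unfold hyp_constant, hyp_coef.
change (qpochs q (RtoC q :: b) j) with (qpoch q (RtoC q) j * qpochs q b j).
assert (HB0 : qpochs_inf q b <> 0).
{ apply Cprod_map_neq0; intros y Hy; apply qpoch_inf_neq0; auto. }
assert (HQ0 : qpoch_inf q (RtoC q) <> 0).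
{ apply qpoch_inf_disk_neq0; auto; rewrite Cmod_RtoC_pos; lra. }
assert (HA0 : qpochs_inf_scaled q a (RtoC (q ^ j)) <> 0).
{ apply Cprod_map_neq0; intros y Hy; apply qpoch_inf_disk_neq0; auto. }
rewrite (qpochs_inf_split q b j hq) in *.
rewrite (qpoch_inf_split q (RtoC q) j hq) in *.
rewrite (qpochs_inf_split q a j hq).
assert (H1 : qpochs q b j <> 0) by (intros E; apply HB0; rewrite E; ring).
assert (H2 : qpochs_inf_scaled q b (RtoC (q ^ j)) <> 0)
  by (intros E; apply HB0; rewrite E; ring).
assert (H3 : qpoch q (RtoC q) j <> 0) by (intros E; apply HQ0; rewrite E; ring).
assert (H4 : qpoch_inf q (RtoC q * RtoC (q ^ j)) <> 0)
  by (intros E; apply HQ0; rewrite E; ring).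
field. auto.
Qed.

Lemma hyp_continuation (q : R) (a b : list C) :
  (0 < q < 1)%R -> length a = S (length b) ->
  (forall y, In y a -> (Cmod y < 1)%R) ->
  (forall y, In y b -> forall n, 1 - y * RtoC (q ^ n) <> 0) ->
  is_hyp_continuation q a b
    (fun x => hyp_constant q a b * total (pole_series q (pole_coef q a b) x)).
Proof.
intros hq Hlen Ha Hb.
assert (Hd := pole_coef_abs_summable q a b hq Hlen Ha).
split; [now apply pole_series_analytic|].
intros x Hx; apply is_pseries_csum.
apply csum_ext with
  (fun j => hyp_constant q a b * (x ^ j * pole_taylor q (pole_coef q a b) 0 j)).
- intros j; rewrite <- hyp_coef_pole_taylor by auto; ring.
- apply csum_scal. rewrite <- (Cplus_0_l x) at 1.
  apply pole_series_taylor with (eta := Cmod x); auto.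
  + intros m; rewrite Cmult_0_l. apply one_minus_neq0; rewrite Cmod_0; lra.
  + split; [apply Cmod_ge_0 | exact Hx].
  + intros m. replace (1 - 0 * RtoC (q ^ m)) with (RtoC 1) by ring.
    rewrite Cmod_1; lra.
Qed.

(** A continuation exists, so the choice operator returns one, and by the
    identity theorem there is only one on the slit plane. *)
Lemma qhyp_pole_series (q : R) (a b : list C) (w : C) :
  (0 < q < 1)%R -> length a = S (length b) ->
  (forall y, In y a -> (Cmod y < 1)%R) ->
  (forall y, In y b -> forall n, 1 - y * RtoC (q ^ n) <> 0) ->
  ~ in_real_ge 1 w ->
  qhyp q a b w = hyp_constant q a b * total (pole_series q (pole_coef q a b) w).
Proof.
intros hq Hlen Ha Hb Hw.
destruct (hyp_continuation q a b hq Hlen Ha Hb) as [HF1 HF2].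
destruct (epsilon_spec (inhabits (fun _ : C => RtoC 0)) (is_hyp_continuation q a b)
  (ex_intro _ _ (hyp_continuation q a b hq Hlen Ha Hb))) as [HG1 HG2].
revert w Hw; apply identity_theorem; auto.
intros w Hw. specialize (HF2 w Hw); specialize (HG2 w Hw).
rewrite is_pseries_csum in HF2, HG2.
exact (csum_unique _ _ _ HG2 HF2).
Qed.

(** * The bilateral sum *)

(** Summing first over the poles that come from the pair (0, q), by the partial
    fraction expansion of (q; q)_inf / (x; q)_inf. *)
Lemma pole_series_inv_qpoch (q : R) (l : list (C * C)) (x : C) :
  (0 < q < 1)%R -> (forall p, In p l -> (Cmod (fst p) < 1)%R) ->
  (forall m, 1 - x * RtoC (q ^ m) <> 0) ->
  csum (fun i => qbin_prod q l i
                 * (qpoch_inf q (RtoC q) / qpoch_inf q (x * RtoC (q ^ i))))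
    (total (pole_series q (qbin_prod q ((RtoC 0, RtoC q) :: l)) x)).
Proof.
intros hq Hl Hx.
destruct (one_minus_qpow_lower q x hq Hx) as (delta & H0 & Hdelta).
assert (Hl1 : forall p, In p l -> (Cmod (fst p * 1) < 1)%R)
  by (intros p Hp; rewrite Cmult_1_r; auto).
assert (Hh : abs_summable (qbin_prod q l)).
{ apply abs_summable_ext with (2 := proj1 (qbin_prod_sum q l 1 hq Hl1)).
  intros m; rewrite Cpow_1_l; apply Cmult_1_r. }
destruct (convolution_csum (qbin_prod q l) (qbin q 0 (RtoC q))
  (fun m => / (1 - x * RtoC (q ^ m)))
  (fun i => qpoch_inf q (RtoC q) / qpoch_inf q (x * RtoC (q ^ i))) (/ delta) Hh
  (qbin_0_abs_summable q hq)) as [T [HT1 HT2]].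
- intros m; now apply Cmod_inv_le.
- intros i.
  assert (Hxi : forall m, 1 - x * RtoC (q ^ i) * RtoC (q ^ m) <> 0).
  { intros m; rewrite <- Cmult_assoc, <- RtoC_qpow_add; apply Hx. }
  apply csum_ext with (2 := inv_qpoch_partial_fractions q _ hq Hxi).
  intros m. now rewrite RtoC_qpow_add, Cmult_assoc.
- rewrite (csum_total (pole_series q (qbin_prod q ((RtoC 0, RtoC q) :: l)) x) T HT2).
  exact HT1.
Qed.

(** Each term h_i / (x q^(n+i); q)_inf is the summand of [inv_qpoch_biseries]
    shifted by i, which costs a factor z^(-i); these factors turn the sum of the
    h_i into the value of their generating function at 1/z. *)
Lemma pole_series_biseries (q : R) (l : list (C * C)) (x z : C) :
  (0 < q < 1)%R -> z <> 0 -> (Cmod z < 1)%R ->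
  (forall p, In p l -> (Cmod (fst p) < Cmod z)%R) ->
  x <> 0 -> (forall n, 1 - x * Cpowz (RtoC q) n <> 0) ->
  is_biseries
    (fun n => total (pole_series q (qbin_prod q ((RtoC 0, RtoC q) :: l))
                       (x * Cpowz (RtoC q) n)) * Cpowz z n)
    (qpoch_inf q (RtoC q)
     * (qratio q l (/ z)
        * (qpoch_inf q (RtoC q) * theta q (x * z) / (theta q x * qpoch_inf q z)))).
Proof.
intros hq Hz Hz1 Hl Hx Hxq; assert (Hq := RtoC_q_neq0 q hq).
assert (Hzpos : (0 < Cmod z)%R) by now apply Cmod_gt_0.
assert (HQ0 : qpoch_inf q (RtoC q) <> 0).
{ apply qpoch_inf_disk_neq0; auto; rewrite Cmod_RtoC_pos; lra. }
assert (Hlz : forall p, In p l -> (Cmod (fst p * / z) < 1)%R).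
{ intros p Hp. specialize (Hl p Hp). rewrite Cmod_mult, Cmod_inv by exact Hz.
  apply Rmult_lt_reg_r with (Cmod z); auto.
  rewrite Rmult_assoc, Rinv_l, Rmult_1_r, Rmult_1_l by lra. exact Hl. }
destruct (qbin_prod_sum q l (/ z) hq Hlz) as [Hc1 Hc2].
assert (Hg1 := inv_qpoch_bi_abs_summable q x z hq Hx Hxq Hz Hz1).
assert (Hg2 := inv_qpoch_biseries q x z hq Hx Hxq Hz Hz1).
set (S := fun n => total (pole_series q (qbin_prod q ((RtoC 0, RtoC q) :: l))
                            (x * Cpowz (RtoC q) n))).
apply is_biseries_ext with
  (fun n => qpoch_inf q (RtoC q) * (/ qpoch_inf q (RtoC q) * (S n * Cpowz z n))).
{ intros n; unfold S. field. exact HQ0. }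
apply is_biseries_scal.
refine (biseries_convolution _ _ _ Z.of_nat _ _ Hc1 Hc2 Hg1 Hg2 _).
intros n.
assert (Hl1 : forall p, In p l -> (Cmod (fst p) < 1)%R).
{ intros p Hp; specialize (Hl p Hp); lra. }
assert (H := pole_series_inv_qpoch q l (x * Cpowz (RtoC q) n) hq Hl1
  (one_minus_qz_shift q x n hq Hxq)).
fold (S n) in H.
replace (/ qpoch_inf q (RtoC q) * (S n * Cpowz z n))
  with (Cpowz z n / qpoch_inf q (RtoC q) * S n) by (field; exact HQ0).
apply csum_ext with (2 := csum_scal _ _ _ H). intros m.
assert (Hnm : qpoch_inf q (x * Cpowz (RtoC q) n * RtoC (q ^ m)) <> 0).
{ apply qpoch_inf_neq0; auto. intros i.
  rewrite <- Cmult_assoc, <- RtoC_qpow_add. now apply one_minus_qz_shift. }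
rewrite !Cpowz_add, Cpowz_qpow, Cpowz_nat, Cpow_inv by auto.
rewrite (Cmult_assoc x).
assert (Hzm := Cpow_nz z m Hz). field. auto.
Qed.

Theorem lemma3p3 (q : R) (k : nat) (a b : list C) (z x : C)
  (hq : (0 < q < 1)%R)
  (ha : length a = S k) (hb : length b = k)
  (hb_lower : forall bi : C, In bi b ->
    forall n : nat, bi <> RtoC (powerRZ q (- Z.of_nat n)))
  (hz_lower : forall ai : C, In ai a -> (Cmod ai < Cmod z)%R)
  (hz_upper : (Cmod z < 1)%R)
  (hx : ~ in_real_ge 0 x) :
  is_biseries
    (fun n : Z => qhyp q a b (x * RtoC (powerRZ q n)) * Cpowz z n)
    (qpochs_inf q (a ++ map (fun bi => bi / z) b
                     ++ [RtoC q; x * z; RtoC q / (x * z)])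
     / qpochs_inf q (b ++ map (fun ai => ai / z) a
                       ++ [z; x; RtoC q / x])).
Proof.
assert (Hlen : length a = S (length b)) by now rewrite hb.
assert (Hq := RtoC_q_neq0 q hq).
assert (Hzpos : (0 < Cmod z)%R).
{ destruct a as [|a0 a']; [easy|].
  apply Rle_lt_trans with (Cmod a0); [apply Cmod_ge_0 | apply hz_lower; now left]. }
assert (Hz : z <> 0) by now apply Cmod_gt_0.
assert (Hray : forall (n : Z) (t : R), (0 <= t)%R -> x * Cpowz (RtoC q) n <> RtoC t).
{ intros n t Ht E; apply hx.
  assert (Hn := powerRZ_lt q n (proj1 hq)).
  rewrite <- Cpowz_RtoC in E by lra.
  assert (Ex : x = RtoC (t / powerRZ q n)).
  { rewrite RtoC_div, <- E by lra. field. apply RtoC_neq0; lra. }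
  rewrite Ex; split; simpl; [easy|].
  apply Rmult_le_pos; [exact Ht | left; now apply Rinv_0_lt_compat]. }
assert (Hx : x <> 0).
{ intros E; apply (Hray 0%Z 0%R); [lra|]. rewrite E; ring. }
assert (Hxq : forall n, 1 - x * Cpowz (RtoC q) n <> 0).
{ intros n E; apply (Hray n 1%R); [lra|].
  transitivity (1 - (1 - x * Cpowz (RtoC q) n)); [ring | rewrite E; ring]. }
assert (Ha1 : forall y, In y a -> (Cmod y < 1)%R)
  by (intros y Hy; specialize (hz_lower y Hy); lra).
assert (Hb := fun y Hy => lower_parameter_no_zero q y hq (hb_lower y Hy)).
assert (Hl : forall p, In p (parameter_pairs a b) -> (Cmod (fst p) < Cmod z)%R).
{ intros [y y'] Hp; apply hz_lower. now apply in_combine_l in Hp. }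
assert (H := is_biseries_scal (hyp_constant q a b) _ _
  (pole_series_biseries q _ x z hq Hz hz_upper Hl Hx Hxq)).
assert (Haz : forall y, In y a -> (Cmod (y * / z) < 1)%R).
{ intros y Hy. specialize (hz_lower y Hy). rewrite Cmod_mult, Cmod_inv by exact Hz.
  apply Rmult_lt_reg_r with (Cmod z); auto.
  rewrite Rmult_assoc, Rinv_l, Rmult_1_r, Rmult_1_l by lra. exact hz_lower. }
rewrite qratio_parameter_pairs in H by auto.
replace (qpochs_inf q (a ++ map (fun bi => bi / z) b
                     ++ [RtoC q; x * z; RtoC q / (x * z)])
     / qpochs_inf q (b ++ map (fun ai => ai / z) a
                       ++ [z; x; RtoC q / x])) with
  (hyp_constant q a b * (qpoch_inf q (RtoC q)
    * (qpochs_inf_scaled q b (/ z) / qpochs_inf_scaled q a (/ z)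
       * (qpoch_inf q (RtoC q) * theta q (x * z) / (theta q x * qpoch_inf q z))))).
- apply is_biseries_ext with (2 := H). intros n.
  rewrite Cpowz_RtoC by lra.
  rewrite qhyp_pole_series; auto; [apply Cmult_assoc|].
  intros [Him Hre]. apply (Hray n (Re (x * Cpowz (RtoC q) n))); [lra|].
  now apply injective_projections.
- rewrite !qpochs_inf_app.
  assert (HB0 : qpochs_inf q b <> 0).
  { apply Cprod_map_neq0; intros y Hy; apply qpoch_inf_neq0; auto. }
  assert (HQ0 : qpoch_inf q (RtoC q) <> 0).
  { apply qpoch_inf_disk_neq0; auto; rewrite Cmod_RtoC_pos; lra. }
  assert (HA0 : qpochs_inf_scaled q a (/ z) <> 0).
  { apply Cprod_map_neq0; intros y Hy; apply qpoch_inf_disk_neq0; auto. }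
  assert (Hz0 := qpoch_inf_disk_neq0 q z hq hz_upper).
  assert (Hth := theta_neq0 q x hq Hx Hxq).
  unfold hyp_constant, theta in *.
  assert (Eb : qpochs_inf q (map (fun bi => bi / z) b) = qpochs_inf_scaled q b (/ z))
    by (unfold qpochs_inf; now rewrite map_map).
  assert (Ea : qpochs_inf q (map (fun ai => ai / z) a) = qpochs_inf_scaled q a (/ z))
    by (unfold qpochs_inf; now rewrite map_map).
  rewrite Ea, Eb.
  change (qpochs_inf q [RtoC q; x * z; RtoC q / (x * z)]) with
    (qpoch_inf q (RtoC q)
     * (qpoch_inf q (x * z) * (qpoch_inf q (RtoC q / (x * z)) * 1))).
  change (qpochs_inf q [z; x; RtoC q / x]) with
    (qpoch_inf q z * (qpoch_inf q x * (qpoch_inf q (RtoC q / x) * 1))).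
  assert (qpoch_inf q x <> 0) by (intros E; apply Hth; rewrite E; ring).
  assert (qpoch_inf q (RtoC q / x) <> 0) by (intros E; apply Hth; rewrite E; ring).
  field. repeat split; assumption.
Qed.
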